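(* Let $k\ge2$ be an integer, $n=k^2$, and let $kS_k$ be the star forest on $n$ vertices. Then (1) $\mathrm{fix}_X(kS_k)<7\sqrt n$ for every collinear set $X$ of $n$ points; (2) there is an absolute constant $c_0$ such that $\mathrm{fix}_X(kS_k)\le c_0\sqrt n\,2^{\alpha(\sqrt n)}$ for every set $X$ of $n$ points in weakly convex position; i.e., $\mathrm{fix}_X(kS_k)=O(\sqrt n\,2^{\alpha(\sqrt n)})$.
   Context: $kS_k$ is the disjoint union of $k$ copies of the star $S_k$ (one center adjacent to $k-1$ leaves). A set is collinear if it lies on a line, and in weakly convex position if it lies on the boundary of a convex plane body. A drawing of a planar graph $G$ is an injective map $\pi\colon V(G)\to\mathbb{R}^2$ with edges drawn as straight segments; a plane straight line drawing is one whose edge segments meet only at common endpoints and contain no other vertex images. $\mathrm{fix}(G,\pi)$ is the maximum over plane straight line drawings $\pi'$ of $|\{v:\pi'(v)=\pi(v)\}|$, and $\mathrm{fix}_X(G)=\min\{\mathrm{fix}(G,\pi):\pi(V(G))=X\}$. Ackermann's function: $A_1(m)=2m$, $A_j(1)=2$, $A_j(m)=A_{j-1}(A_j(m-1))$ for $m,j\ge2$, $A(m)=A_m(m)$; its inverse is $\alpha(m)=\min\{t\ge1:A(t)\ge m\}$. *)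

(* Defs.v *)
From HB Require Import structures.
From mathcomp Require Import all_boot all_order all_algebra.
From mathcomp Require Import all_classical all_reals all_analysis.

Set Implicit Arguments.
Unset Strict Implicit.
Unset Printing Implicit Defensive.

Import Order.TTheory GRing.Theory Num.Theory numFieldNormedType.Exports.

Local Open Scope classical_set_scope.
Local Open Scope ring_scope.

Section PlanePoints.
Variable R : realType.
Implicit Types (p q : R * R) (X K : set (R * R)).

Definition segment p q : set (R * R) :=
  [set (1 - t) *: p + t *: q | t in `[0, 1]].

Definition line (a b c : R) : set (R * R) :=
  [set p | a * p.1 + b * p.2 = c].

Definition collinear X :=
  exists a b c, (a, b) != (0, 0) /\ X `<=` line a b c.

Definition boundary K : set (R * R) := closure K `\` interior K.

Definition convex_body K :=
  [/\ compact K, convex_set K & interior K !=set0].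

Definition weakly_convex_position X :=
  exists2 K, convex_body K & X `<=` boundary K.

End PlanePoints.

(* A graph on the finite vertex type V is given by its symmetric irreflexive  *)
(* adjacency relation.                                                        *)
Section Untangling.
Variables (R : realType) (V : finType) (adj : rel V).
Implicit Types (pi : V -> R * R) (X : set (R * R)).

Definition edge_segment pi (u v : V) := segment (pi u) (pi v).

Definition plane_drawing pi :=
  [/\ injective pi,
      forall u v w, adj u v -> edge_segment pi u v (pi w) -> w = u \/ w = v
    & forall u v u' v', adj u v -> adj u' v' ->
        [set u; v]%SET != [set u'; v']%SET ->
        forall p, edge_segment pi u v p -> edge_segment pi u' v' p ->
          exists2 w, w \in ([set u; v] :&: [set u'; v'])%SET & p = pi w].

Definition num_fixed pi pi' : nat := #|[pred v | pi' v == pi v]|.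

Definition fix_drawing pi : nat :=
  \max_(m < #|V|.+1 |
      `[< exists2 pi', plane_drawing pi' & num_fixed pi pi' = m >]) m.

(* The default value #|V| of the minimum is returned only if no drawing has   *)
(* image X or if it is the minimum; see fix_setP.                             *)
Definition fix_set X : nat :=
  \big[minn/#|V|]_(m < #|V|.+1 |
      `[< exists pi, [/\ injective pi, range pi = X & fix_drawing pi = m] >]) m.

Lemma fix_drawing_ge pi pi' :
  plane_drawing pi' -> (num_fixed pi pi' <= fix_drawing pi)%N.
Proof.
move=> Hpi'; have mlt : (num_fixed pi pi' < #|V|.+1)%N by rewrite ltnS max_card.
by apply: (@leq_bigmax_cond _ _ (@nat_of_ord _) (Ordinal mlt)); apply/asboolP; exists pi'.
Qed.

Lemma fix_drawing_attained pi : (exists pi', plane_drawing pi') ->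
  exists2 pi', plane_drawing pi' & num_fixed pi pi' = fix_drawing pi.
Proof.
move=> [pi' Hpi'].
have mlt : (num_fixed pi pi' < #|V|.+1)%N by rewrite ltnS max_card.
pose P (m : 'I_#|V|.+1) :=
  `[< exists2 pi', plane_drawing pi' & num_fixed pi pi' = m >].
have P0 : P (Ordinal mlt) by apply/asboolP; exists pi'.
rewrite /fix_drawing (@bigop.bigmax_eq_arg _ (Ordinal mlt) P (@nat_of_ord _)) //.
by case: arg_maxnP => // i /asboolP [pi2 ? ?] _; exists pi2.
Qed.

Lemma fix_drawing_le_card pi : (fix_drawing pi <= #|V|)%N.
Proof. by apply/bigmax_leqP => i _; rewrite -ltnS. Qed.

Lemma fix_setP X : (exists2 pi : V -> R * R, injective pi & range pi = X) ->
  (exists pi, [/\ injective pi, range pi = X & fix_drawing pi = fix_set X]) /\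
  (forall pi, injective pi -> range pi = X -> (fix_set X <= fix_drawing pi)%N).
Proof.
have le_fix pi : injective pi -> range pi = X ->
    (fix_set X <= fix_drawing pi)%N.
  move=> ipi Xpi.
  have mlt : (fix_drawing pi < #|V|.+1)%N by rewrite ltnS fix_drawing_le_card.
  rewrite /fix_set -minEnat -leEnat.
  by apply: (@bigmin_le_cond _ nat _ _ (Ordinal mlt)); apply/asboolP; exists pi.
move=> [pi ipi Xpi]; split=> //.
suff [E|//] : fix_set X = #|V| \/
    exists pi, [/\ injective pi, range pi = X & fix_drawing pi = fix_set X].
  exists pi; split=> //; apply/eqP; rewrite eqn_leq le_fix // andbT E.
  exact: fix_drawing_le_card.
rewrite {1 2}/fix_set.
elim/big_ind: _ => [|m m' IHm IHm'|m /asboolP ?]; [by left| |by right].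
by case: (leqP m m').
Qed.

End Untangling.

Definition star (m : nat) : rel 'I_m :=
  [rel i j | (val i == 0%N) (+) (val j == 0%N)].
Arguments star m : clear implicits.

Definition disjoint_copies (k : nat) (V : finType) (adj : rel V) :
    rel ('I_k * V)%type :=
  [rel u v | (u.1 == v.1) && adj u.2 v.2].
Arguments disjoint_copies k {V} adj.

Definition star_forest (k : nat) : rel ('I_k * 'I_k)%type :=
  disjoint_copies k (star k).
Arguments star_forest k : clear implicits.

(* Only the values at indices j, m >= 1 are meaningful.                       *)
Fixpoint ackermann_level (j : nat) : nat -> nat :=
  match j with
  | 0 => fun=> 0%N
  | 1 => fun m => (2 * m)%N
  | j'.+1 => fix A_j (m : nat) : nat :=
      match m with
      | 0 => 0%N
      | 1 => 2%N
      | m'.+1 => ackermann_level j' (A_j m')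
      end
  end.

Definition ackermann (m : nat) : nat := ackermann_level m m.

Lemma ackermann_level1 m : ackermann_level 1 m = (2 * m)%N.
Proof. by []. Qed.

Lemma ackermann_level_at1 j : (2 <= j)%N -> ackermann_level j 1 = 2%N.
Proof. by case: j => [|[|j]]. Qed.

Lemma ackermann_levelE j m : (2 <= j)%N -> (2 <= m)%N ->
  ackermann_level j m = ackermann_level j.-1 (ackermann_level j m.-1).
Proof. by case: j => [|[|j]] //; case: m => [|[|m]]. Qed.

Lemma ackermann_level_gt j m :
  (1 <= j)%N -> (1 <= m)%N -> (m < ackermann_level j m)%N.
Proof.
case: j => // j _; elim: j m => [|j IHj] m.
  by move=> m1; rewrite ackermann_level1 mul2n -addnn -[X in (X < _)%N]addn0 ltn_add2l.
case: m => // m _; elim: m => [//|m IHm].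
rewrite ackermann_levelE //= -/(ackermann_level j.+2 m.+1).
by apply: leq_trans (IHj _ _) => //; apply: leq_trans IHm.
Qed.

Lemma ackermann_unbounded (R : realType) (x : R) :
  exists t, (1 <= t)%N && (x <= (ackermann t)%:R).
Proof.
exists (Num.truncn x).+1; apply/andP; split=> //.
apply: le_trans (ltW (truncnS_gt x)) _.
by rewrite ler_nat ltnW // ackermann_level_gt.
Qed.

(* Real argument, so that it applies to a square root.                        *)
Definition inverse_ackermann (R : realType) (x : R) : nat :=
  ex_minn (ackermann_unbounded x).

(* Main.v *)
Require Import Defs.
From mathcomp Require Import all_boot all_order all_algebra.
From mathcomp Require Import all_classical all_reals all_analysis.
From mathcomp Require Import ring lra zify.

(** The points of [X] are sorted along a generic direction and the point of rank [j * k + i] is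
given to the [i]-th star, so that every block [j] of [k] consecutive points meets every star
exactly once.  It turns out that every plane drawing then fixes only [O(k)] points, even in weakly
convex position.

A finite set in weakly convex position splits into a concave and a convex chain, and by
reflections it suffices to count edges that go from the centre to the right and end on the graph of
a concave function [g].  If the whole edge runs above the graph, or if its centre lies under the
graph, then two stars cannot alternate [a b a b] along the chain; hence a leaf that is neither the
last of its star nor the last of its block is followed by the first leaf of another star.

Otherwise the edge starts above the graph, dives below it at an abscissa [e] and reaches its leaf
[x] from below.  The intervals [(e, x)] are laminar, and those of one star are nested.  If the next
leaf [h] after [v] lies in the same block and its interval contains that of [v], the star of [h] is
trapped between two edges of the star of [v]: all leaves of [h]'s star before [h] lie between the
two entry points, so there is at most one of them when these entry points are in one block, and
otherwise [v] is the outermost interval that leaves the block of its entry point.  Each alternative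
occurs [O(k)] times.

For collinear [X] the centres on either side of the line give noncrossing families and a centre on
the line has at most two leaves, which yields [5 k]. *)

Set Implicit Arguments.
Unset Strict Implicit.
Unset Printing Implicit Defensive.

Import Order.TTheory GRing.Theory Num.Theory numFieldNormedType.Exports.

Local Open Scope classical_set_scope.
Local Open Scope ring_scope.
Local Open Scope card_scope.

(** * Counting coloured points on a line *)

(** Two extremal elements of one fibre of [f] are [r]-related in both directions, so [f] is
    injective on the extremal elements. *)
Lemma card_extremal (V T : finType) (S : {set V}) (f : V -> T) (r : rel V) :
  {in S &, antisymmetric r} ->
  (#|[set v in S | [forall w in S, (f w == f v) ==> r v w]]| <= #|f @: S|)%N.
Proof.
move=> ras; rewrite -(card_in_imset (f := f)).
  by apply/subset_leq_card/imsetS/fintype.subsetP => v; rewrite inE => /andP[].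
move=> v w; rewrite !inE => /andP[vS /forall_inP hv] /andP[wS /forall_inP hw] fvw.
apply: ras => //; apply/andP; split.
  by apply: (implyP (hv w wS)); rewrite fvw.
by apply: (implyP (hw v vS)); rewrite fvw.
Qed.

Lemma card_imset_ord (T : finType) (k : nat) (f : T -> 'I_k) (A : {set T}) :
  (#|f @: A| <= k)%N.
Proof. by rewrite -[X in (_ <= X)%N]card_ord max_card. Qed.

Section Counting.
Variables (R : realDomainType) (V : finType) (k : nat) (col blk : V -> 'I_k).
Variables (x : V -> R) (S : {set V}).
Hypothesis x_inj : {in S &, injective x}.
Hypothesis col_blk_inj : {in S &, forall u v, col u = col v -> blk u = blk v -> u = v}.
Hypothesis blk_mono : {in S &, forall u v, x u < x v -> (blk u <= blk v)%N}.

Definition firsts := [set v in S | [forall w in S, (col w == col v) ==> (x v <= x w)]].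
Definition lasts := [set v in S | [forall w in S, (col w == col v) ==> (x w <= x v)]].
Definition block_lasts := [set v in S | [forall w in S, (blk w == blk v) ==> (x w <= x v)]].

Let x_antisym : {in S &, antisymmetric (fun v w => x v <= x w)}.
Proof. by move=> v w vS wS /le_anti /x_inj; apply. Qed.

Let x_antisym' : {in S &, antisymmetric (fun v w => x w <= x v)}.
Proof. by move=> v w vS wS /le_anti /x_inj h; rewrite h. Qed.

Lemma card_firsts : (#|firsts| <= #|col @: S|)%N.
Proof. exact: card_extremal. Qed.

Lemma card_lasts : (#|lasts| <= #|col @: S|)%N.
Proof. exact: card_extremal. Qed.

Lemma card_block_lasts : (#|block_lasts| <= k)%N.
Proof. by apply: leq_trans (card_imset_ord blk S); exact: card_extremal. Qed.

Definition succ_in v h := [&& h \in S, x v < x h & [forall w in S, (x v < x w) ==> (x h <= x w)]].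

Lemma succ_inP v h : reflect [/\ h \in S, x v < x h & forall w, w \in S -> x v < x w -> x h <= x w]
  (succ_in v h).
Proof.
apply: (iffP and3P) => -[hS vh H]; split=> //.
  by move=> w wS; apply/implyP/(forall_inP H).
by apply/forall_inP => w wS; apply/implyP/H.
Qed.

Lemma succ_in_exists v w : w \in S -> x v < x w -> exists h, succ_in v h.
Proof.
move=> wS vw.
pose P : pred V := fun u => (u \in S) && (x v < x u).
have Pw : P w by rewrite /P wS.
case: (arg_minP x Pw) => h /andP[hS vh] hmin.
by exists h; apply/succ_inP; split=> // u uS vu; apply: hmin; rewrite /P uS.
Qed.

(** Taking successors is injective: of two points with a common successor, the right one would lie
    strictly between the left one and that successor. *)
Lemma card_succ (N T : {set V}) : {subset N <= S} ->
  (forall v, v \in N -> exists2 h, h \in T & succ_in v h) -> (#|N| <= #|T|)%N.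
Proof.
move=> NS HN; pose nx v := odflt v [pick h in T | succ_in v h].
have nxP v : v \in N -> nx v \in T /\ succ_in v (nx v).
  move=> /HN[h hT vh]; rewrite /nx; case: pickP => [h' /andP[]//|/(_ h)].
  by rewrite /= hT vh.
rewrite -(card_in_imset (f := nx)).
  by apply/subset_leq_card/fintype.subsetP => _ /imsetP[v vN ->]; have [] := nxP v vN.
move=> v w vN wN E; apply: x_inj; [exact: NS|exact: NS|].
have [_ /succ_inP[_ vh hv]] := nxP v vN; have [_ /succ_inP[_ wh hw]] := nxP w wN.
rewrite E in vh hv; case: (ltgtP (x v) (x w)) => // lt.
  by have := hv w (NS _ wN) lt; rewrite leNgt wh.
by have := hw v (NS _ vN) lt; rewrite leNgt vh.
Qed.

(** The next point [h] comes no later than a later point of the block of [v], hence lies in that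
    block. A block meets a star at most once, so [h] has another colour and a later leaf of the star
    of [v] lies strictly beyond it. *)
Lemma succ_in_same_block v : v \in S -> v \notin lasts -> v \notin block_lasts ->
  exists h a, [/\ succ_in v h, blk h = blk v, a \in S, col a = col v & x h < x a /\ col h != col v].
Proof.
move=> vS; rewrite !inE vS /= => /forall_inPn[a aS]; rewrite negb_imply -ltNge => /andP[/eqP ca va].
move=> /forall_inPn[b bS]; rewrite negb_imply -ltNge => /andP[/eqP cb vb].
have [h vh] := succ_in_exists aS va; have /succ_inP[hS xvh hmin] := vh.
have bh : blk h = blk v.
  apply/val_inj/eqP; rewrite eqn_leq (blk_mono vS hS xvh) andbT -cb.
  have := hmin b bS vb; rewrite le_eqVlt => /orP[/eqP/x_inj ->//|]; exact: blk_mono.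
have chv : col h != col v.
  apply/eqP => chv; have E := col_blk_inj hS vS chv bh.
  by rewrite E ltxx in xvh.
exists h, a; split=> //; split=> //; rewrite lt_neqAle hmin // andbT.
by apply/eqP => /x_inj E; rewrite E // ca eqxx in chv.
Qed.

(* The successor [b] of [a] in its block is trapped in the wedge of the star of [a] spanned *)
(* by [a] and a later leaf, hence is the first leaf of its own star.                        *)
Lemma card_noncrossing :
  {in S &, forall a b, {in S &, forall a' b', col a' = col a -> col b' = col b ->
     col b != col a -> x a < x b -> x b < x a' -> x a < x b'}} ->
  (#|S| <= #|col @: S| + #|col @: S| + k)%N.
Proof.
move=> wedge.
have S_sub : S \subset (lasts :|: block_lasts) :|: (S :\: (lasts :|: block_lasts)).
  by apply/fintype.subsetP => v vS; rewrite finset.in_setU finset.in_setD vS andbT orbN.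
apply: leq_trans (subset_leq_card S_sub) _.
apply: leq_trans (leq_card_setU _ _) _.
rewrite -addnA (addnC #|_ @: _| k) addnA leq_add //.
  by apply: leq_trans (leq_card_setU _ _) _; rewrite leq_add ?card_lasts ?card_block_lasts.
apply: leq_trans (card_firsts); apply: card_succ.
  by move=> v; rewrite finset.in_setD => /andP[].
move=> v; rewrite finset.in_setD finset.in_setU negb_or => /andP[/andP[nl nb] vS].
have [h [a [vh _ aS ca [ha hv]]]] := succ_in_same_block vS nl nb.
exists h => //; have /succ_inP[hS xvh hmin] := vh.
rewrite inE hS; apply/forall_inP => b bS; apply/implyP => /eqP cb; apply: hmin => //.
exact: (wedge v h vS hS a b).
Qed.

(** * Leaves reached from below: laminar intervals from [e v] to [x v] *)

Section Laminar.
Variables (e : V -> R) (B : R -> 'I_k).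
Hypothesis B_mono : {homo B : s t / s <= t >-> (s <= t)%N}.
Hypothesis B_blk : {in S, forall v, B (x v) = blk v}.
Hypothesis e_lt : {in S, forall v, e v < x v}.
Hypothesis e_inj : {in S &, injective e}.
Hypothesis laminar : {in S &, forall u v, e u < e v -> e v < x u -> x u < x v -> False}.
Hypothesis nested : {in S &, forall u v, col u = col v -> x u < x v -> e v < e u}.
Hypothesis wedge : {in S &, forall a b, {in S &, forall a' b', col a' = col a -> col b' = col b ->
     col b != col a -> x a < x b -> x b < x a' -> e b < e a -> x b' < e a \/ x a < x b'}}.

Definition long := [set v in S | B (e v) != B (x v)].
(** Long intervals entered in one block all run past the end of that block, so they overlap pairwise
    and are nested by laminarity; the leftmost entry belongs to the outermost one. *)
Definition outermost := [set v in long | [forall w in long, (B (e w) == B (e v)) ==> (e v <= e w)]].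
Definition seconds := [set v in S :\: firsts |
  [forall w in S, (col w == col v) ==> (x v <= x w) || (w \in firsts)]].

Lemma card_outermost : (#|outermost| <= k)%N.
Proof.
apply: leq_trans (card_imset_ord (B \o e) long).
rewrite /outermost; apply: (card_extremal (B \o e) (r := fun v w => e v <= e w)).
by move=> v w; rewrite !inE => /andP[vS _] /andP[wS _] /le_anti /e_inj; apply.
Qed.

Lemma card_seconds : (#|seconds| <= #|col @: S|)%N.
Proof.
apply: leq_trans (_ : #|col @: (S :\: firsts)| <= _)%N; last first.
  by apply/subset_leq_card/imsetS/subsetDl.
apply: leq_trans (card_extremal col (r := fun v w => x v <= x w) _); last first.
  by move=> v w; rewrite !finset.in_setD => /andP[_ vS] /andP[_ wS] /le_anti /x_inj; apply.
apply/subset_leq_card/fintype.subsetP => v; rewrite !(inE, finset.in_setD).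
move=> /andP[-> /forall_inP H] /=; apply/forall_inP => w; rewrite finset.in_setD => /andP[wf wS].
apply/implyP => cw; have := implyP (H w wS) cw; rewrite (negPf wf) orbF //.
Qed.

(** By nesting, an earlier leaf of the star has its interval inside that of [v]; if the latter
    stayed in one block, this block would meet the star twice. *)
Lemma short_firsts v : v \in S -> v \notin long -> v \in firsts.
Proof.
move=> vS; rewrite !inE vS /= negbK => /eqP Bv.
apply/forall_inP => w wS; apply/implyP => /eqP cw; rewrite leNgt; apply/negP => wv.
have ew := nested wS vS cw wv; have xw := e_lt wS.
have E : w = v.
  apply: col_blk_inj => //; rewrite -!B_blk //; apply/val_inj/eqP.
  by rewrite eqn_leq B_mono ?(ltW wv) //= -Bv B_mono // ltW // (lt_trans ew).
by rewrite E ltxx in wv.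
Qed.

Lemma card_laminar : (#|S| <= 6 * k)%N.
Proof.
(* Four classes of at most [k] leaves are set aside. The successor of any other leaf is the first or
   second leaf of its star, which adds [2 * k]. *)
pose A := lasts :|: block_lasts :|: firsts :|: outermost.
have S_sub : S \subset A :|: (S :\: A).
  by apply/fintype.subsetP => v vS; rewrite finset.in_setU finset.in_setD vS andbT orbN.
apply: leq_trans (subset_leq_card S_sub) _; apply: leq_trans (leq_card_setU _ _) _.
have cle := card_imset_ord col S.
have cA : (#|A| <= 4 * k)%N.
  rewrite (_ : 4 * k = k + k + k + k)%N; last by rewrite !mulSn mul0n addn0 !addnA.
  apply: leq_trans (leq_card_setU _ _) _; apply: leq_add; last exact: card_outermost.
  apply: leq_trans (leq_card_setU _ _) _; apply: leq_add; last exact: leq_trans card_firsts _.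
  apply: leq_trans (leq_card_setU _ _) _; apply: leq_add; last exact: card_block_lasts.
  exact: leq_trans card_lasts _.
rewrite (_ : 6 * k = 4 * k + (k + k))%N; last by rewrite addnn -mul2n -mulnDl.
apply: leq_add => //; apply: (@leq_trans #|firsts :|: seconds|); last first.
  apply: leq_trans (leq_card_setU _ _) _.
  by apply: leq_add; [apply: leq_trans card_firsts _|apply: leq_trans card_seconds _].
apply: card_succ; first by move=> v; rewrite finset.in_setD => /andP[].
move=> v; rewrite finset.in_setD !finset.in_setU !negb_or => /andP[/andP[/andP[/andP[nl nb] nf] no] vS].
have [h [a [vh bh aS ca [ha hv]]]] := succ_in_same_block vS nl nb.
exists h => //; have /succ_inP[hS xvh hmin] := vh.
(* If the interval of [h] starts at [v] or later, an earlier leaf of the star of [h] would, by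
   nesting, lie strictly between [v] and [h]. *)
have [evh|ehv] := leP (x v) (e h).
  rewrite finset.in_setU; apply/orP; left; rewrite inE hS; apply/forall_inP => b bS.
  apply/implyP => /eqP cb; rewrite leNgt; apply/negP => bh'.
  have := hmin b bS; rewrite leNgt bh' => /(_ _)/negP H; apply: H => //.
  exact: le_lt_trans evh (lt_trans (nested bS hS cb bh') (e_lt bS)).
have {}ehv : e h < e v.
  rewrite ltNge le_eqVlt; apply/negP => /orP[/eqP/e_inj E|evh].
    by rewrite E // ltxx in xvh.
  exact: laminar evh ehv xvh.
(* Now the interval of [h] contains that of [v]. If the entries lie in different blocks, [v] is
   outermost: a long interval entered further left in the block of [e v] would cross the interval of
   [v] or that of [h]. *)
have [Bhv|Bhv] := eqVneq (B (e h)) (B (e v)); last first.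
  case/negP: no; rewrite inE.
  have -> : v \in long by apply: contraNT nf; apply: short_firsts.
  apply/forall_inP => w; rewrite inE => /andP[wS wl]; apply/implyP => /eqP Bw.
  rewrite leNgt; apply/negP => ewv.
  have ehw : e h < e w.
    rewrite ltNge; apply/negP => ewh; case/eqP: Bhv; apply/val_inj/eqP.
    by rewrite eqn_leq B_mono ?(ltW ehv) //= -Bw B_mono.
  have xwe : e v < x w.
    rewrite ltNge; apply/negP => xwe; case/eqP: wl; apply/val_inj/eqP.
    by rewrite eqn_leq B_mono ?(ltW (e_lt wS)) //= Bw B_mono.
  case: (ltgtP (x w) (x v)) => [xwv|xvw|/x_inj E]; last by rewrite E // ltxx in ewv.
    exact: laminar ewv xwe xwv.
  have := hmin w wS xvw; rewrite le_eqVlt => /orP[/eqP/x_inj E|hw].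
    by rewrite E // ltxx in ehw.
  apply: (laminar hS wS ehw _ hw).
  exact: lt_trans ewv (lt_trans (e_lt vS) xvh).
rewrite finset.in_setU; have [//|hnf] := boolP (h \in firsts) => /=.
(* By nesting and the wedge, the earlier leaves of the star of [h] lie between [e h] and [e v],
   hence all in one block, so there is at most one. *)
have low b : b \in S -> col b = col h -> x b < x h -> blk b = B (e v).
  move=> bS cb bh'; rewrite -B_blk //; apply/val_inj/eqP.
  have eb := nested bS hS cb bh'.
  have xb : x b < e v.
    case: (wedge vS hS aS bS ca cb hv xvh ha ehv) => // xvb.
    by have := hmin b bS xvb; rewrite leNgt bh'.
  by rewrite eqn_leq B_mono ?(ltW xb) //= -Bhv B_mono // ltW // (lt_trans eb) // e_lt.
rewrite inE finset.in_setD hnf hS; apply/forall_inP => w wS; apply/implyP => /eqP cw.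
case: leP => //= wh; rewrite inE wS; apply/forall_inP => u uS; apply/implyP => /eqP cu.
rewrite leNgt; apply/negP => uw; have E : u = w.
  apply: col_blk_inj => //; rewrite low ?low //; [by rewrite cu|exact: lt_trans uw wh].
by rewrite E ltxx in uw.
Qed.
End Laminar.
End Counting.

(** * Segments, cones and concave graphs *)

Section PlaneGeometry.
Variable R : realType.
Implicit Types (p q a b c z w f : R * R).

(** Twice the signed area of the triangle [p a b], positive for a counterclockwise turn. *)
Definition det p a b : R := (a.1 - p.1) * (b.2 - p.2) - (a.2 - p.2) * (b.1 - p.1).

Lemma segmentP p q z : segment p q z <->
  exists t, [/\ 0 <= t, t <= 1, z.1 = (1 - t) * p.1 + t * q.1
              & z.2 = (1 - t) * p.2 + t * q.2].
Proof.
split=> [[t]|[t [t0 t1 z1 z2]]].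
  by rewrite /= in_itv /= => /andP[t0 t1] <-; exists t.
by exists t; rewrite /= ?in_itv /= ?t0 //; apply: injective_projections.
Qed.

Lemma segment_left p q : segment p q p.
Proof. by apply/segmentP; exists 0; split=> //; ring. Qed.

Lemma segment_right p q : segment p q q.
Proof. by apply/segmentP; exists 1; split=> //; ring. Qed.

Lemma segment_sym p q z : segment p q z -> segment q p z.
Proof.
by move=> /segmentP[t [t0 t1 z1 z2]]; apply/segmentP; exists (1 - t); split; lra.
Qed.

Lemma segment_trans p q z w : segment p q z -> segment p z w -> segment p q w.
Proof.
move=> /segmentP[t [t0 t1 z1 z2]] /segmentP[s [s0 s1 w1 w2]].
apply/segmentP; exists (t * s); split; [nra|nra|rewrite w1 z1|rewrite w2 z2]; ring.
Qed.

Lemma det_swap p a b : det p b a = - det p a b.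
Proof. by rewrite /det; ring. Qed.

Lemma det_segment a b z w c t : c.1 = (1 - t) * z.1 + t * w.1 ->
  c.2 = (1 - t) * z.2 + t * w.2 -> det a b c = (1 - t) * det a b z + t * det a b w.
Proof. by move=> c1 c2; rewrite /det c1 c2; ring. Qed.

(** At the earlier of the zeros of two affine functions the other has not yet turned negative. This
    finds the first point where a segment leaves a cone. *)
Lemma first_zero (A0 A1 B0 B1 : R) : 0 < A0 -> 0 < B0 -> A1 <= 0 \/ B1 <= 0 ->
  exists t, [/\ 0 <= t, t <= 1 &
    (1 - t) * A0 + t * A1 = 0 /\ 0 <= (1 - t) * B0 + t * B1 \/
    (1 - t) * B0 + t * B1 = 0 /\ 0 <= (1 - t) * A0 + t * A1].
Proof.
have zero (C0 C1 : R) : 0 < C0 -> C1 <= 0 -> exists t,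
    [/\ 0 <= t, t <= 1, (1 - t) * C0 + t * C1 = 0 &
      forall s, s <= t -> 0 <= (1 - s) * C0 + s * C1].
  move=> C00 C10; have C : 0 < C0 - C1 by lra.
  pose t := C0 / (C0 - C1); have Et : t * (C0 - C1) = C0.
    by rewrite /t mulfVK // gt_eqF.
  by exists t; split; [nra|nra|nra|move=> s st; nra].
move=> A00 B00 [A10|B10].
  have [t [t0 t1 At As]] := zero _ _ A00 A10.
  have [Bt|Bt] := leP 0 ((1 - t) * B0 + t * B1); first by exists t; split=> //; left.
  have B10 : B1 <= 0 by nra.
  have [u [u0 u1 Bu Bs]] := zero _ _ B00 B10; exists u; split=> //; right; split=> //.
  by apply: As; rewrite leNgt; apply/negP => tu; have := Bs t (ltW tu); lra.
have [t [t0 t1 Bt Bs]] := zero _ _ B00 B10.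
have [At|At] := leP 0 ((1 - t) * A0 + t * A1); first by exists t; split=> //; right.
have A10 : A1 <= 0 by nra.
have [u [u0 u1 Au As]] := zero _ _ A00 A10; exists u; split=> //; left; split=> //.
by apply: Bs; rewrite leNgt; apply/negP => tu; have := As t (ltW tu); lra.
Qed.

Definition on_ray p a c := exists2 s, 0 <= s &
  c.1 = p.1 + s * (a.1 - p.1) /\ c.2 = p.2 + s * (a.2 - p.2).

(* Cramer's rule *)
Lemma on_rayP p a a' c : 0 < det p a a' -> det p a c = 0 -> 0 <= det p c a' ->
  on_ray p a c.
Proof.
move=> D H0 H1; exists (det p c a' / det p a a'); first by rewrite divr_ge0 // ltW.
have D0 : det p a a' != 0 by rewrite gt_eqF.
have E1 : det p a a' * (c.1 - p.1) =
    det p c a' * (a.1 - p.1) + det p a c * (a'.1 - p.1) by rewrite /det; ring.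
have E2 : det p a a' * (c.2 - p.2) =
    det p c a' * (a.2 - p.2) + det p a c * (a'.2 - p.2) by rewrite /det; ring.
by split; apply: (mulfI D0); rewrite mulrDr mulrA mulrCA mulfV // mulr1;
  rewrite H0 mul0r addr0 in E1; rewrite H0 mul0r addr0 in E2; rewrite -?E1 -?E2; ring.
Qed.

Lemma cone_exit p a a' z w : 0 < det p a a' -> 0 < det p a z -> 0 < det p z a' ->
  (forall c, segment z w c -> on_ray p a c -> False) ->
  (forall c, segment z w c -> on_ray p a' c -> False) ->
  0 < det p a w /\ 0 < det p w a'.
Proof.
move=> D z1 z2 Ha Ha'.
have bad : det p a w <= 0 \/ det p w a' <= 0 -> False.
  move=> /(first_zero z1 z2)[t [t0 t1 H]].
  pose c := ((1 - t) * z.1 + t * w.1, (1 - t) * z.2 + t * w.2).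
  have cs : segment z w c by apply/segmentP; exists t.
  have E1 : det p a c = (1 - t) * det p a z + t * det p a w by exact: det_segment.
  have E2 : det p c a' = (1 - t) * det p z a' + t * det p w a'.
    by rewrite !(det_swap p a') (@det_segment p a' z w c t) //; ring.
  rewrite -E1 -E2 in H; case: H => -[H1 H2]; first exact: (Ha c cs (on_rayP D H1 H2)).
  (* With the reflection of [a] through [p] as second generator, Cramer's rule applies to the ray of
     [a']. *)
  apply: (Ha' c cs); apply: (@on_rayP p a' (2 * p.1 - a.1, 2 * p.2 - a.2) c).
  - by move: D; rewrite /det /=; lra.
  - by rewrite det_swap H1 oppr0.
  - by move: H2; rewrite /det /=; lra.
by split; rewrite ltNge; apply/negP => w0; apply: bad; [left|right].
Qed.

(** At parameter [s] of the ray, [det c a a'] equals [(1 - s) * det p a a'], so its sign separates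
    the edge from its extension. *)
Lemma on_ray_segment p a a' c : 0 < det p a a' -> on_ray p a c -> 0 <= det c a a' ->
  segment p a c.
Proof.
move=> D [s s0 [c1 c2]] ca; apply/segmentP; exists s; split=> //; rewrite ?c1 ?c2; try ring.
have : det c a a' = (1 - s) * det p a a' by rewrite /det c1 c2; ring.
by move=> E; rewrite E pmulr_lge0 // in ca; lra.
Qed.

Lemma on_ray_segment' p a a' c : 0 < det p a a' -> on_ray p a' c -> 0 <= det c a a' ->
  segment p a' c.
Proof.
move=> D [s s0 [c1 c2]] ca; apply/segmentP; exists s; split=> //; rewrite ?c1 ?c2; try ring.
have : det c a a' = (1 - s) * det p a a' by rewrite /det c1 c2; ring.
by move=> E; rewrite E pmulr_lge0 // in ca; lra.
Qed.

(** The vector from [p] to [z] is a positive combination of two vectors that point right. *)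
Lemma cone_right p a a' z : p.1 < a.1 -> p.1 < a'.1 -> 0 < det p a a' ->
  0 < det p a z -> 0 < det p z a' -> p.1 < z.1.
Proof.
move=> pa pa' D z1 z2; rewrite ltNge; apply/negP => zp.
have : (p.1 - z.1) * det p a a' + (a'.1 - p.1) * det p a z + (a.1 - p.1) * det p z a' = 0.
  by rewrite /det; ring.
have : 0 <= (p.1 - z.1) * det p a a' by apply: mulr_ge0; lra.
have : 0 < (a'.1 - p.1) * det p a z by apply: mulr_gt0; lra.
have : 0 < (a.1 - p.1) * det p z a' by apply: mulr_gt0; lra.
by lra.
Qed.

Lemma det_segment0 a a' z w c t : c.1 = (1 - t) * z.1 + t * w.1 ->
  c.2 = (1 - t) * z.2 + t * w.2 -> det c a a' = (1 - t) * det z a a' + t * det w a a'.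
Proof. by move=> c1 c2; rewrite /det c1 c2; ring. Qed.

(** On the side of the line [a a'] that contains [p], points of the two rays belong to the edges
    themselves, so [cone_exit] applies up to the point where the segment meets that line. *)
Lemma triangle_exit p a a' z w : 0 < det p a a' -> 0 < det p a z -> 0 < det p z a' ->
  0 <= det z a a' ->
  (forall c, segment z w c -> segment p a c -> False) ->
  (forall c, segment z w c -> segment p a' c -> False) ->
  [/\ 0 < det p a w, 0 < det p w a' & 0 <= det w a a'] \/
  det w a a' < 0 /\
  exists c, [/\ segment z w c, 0 < det p a c, 0 < det p c a' & det c a a' = 0].
Proof.
move=> D z1 z2 z0 Ha Ha'.
have in_tri v : segment z w v -> 0 <= det v a a' -> 0 < det p a v /\ 0 < det p v a'.
  move=> wv v0; apply: (cone_exit D z1 z2) => c cs.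
    move=> /(on_ray_segment D) H; apply: (Ha c (segment_trans wv cs)); apply: H.
    case/segmentP: cs => t [t0 t1 c1 c2]; rewrite (det_segment0 a a' c1 c2).
    by rewrite addr_ge0 // mulr_ge0 //; lra.
  move=> /(on_ray_segment' D) H; apply: (Ha' c (segment_trans wv cs)); apply: H.
  case/segmentP: cs => t [t0 t1 c1 c2]; rewrite (det_segment0 a a' c1 c2).
  by rewrite addr_ge0 // mulr_ge0 //; lra.
have [w0|w0] := leP 0 (det w a a').
  by left; have [] := in_tri w (segment_right _ _) w0.
right; split=> //.
pose t := det z a a' / (det z a a' - det w a a').
have Dt : 0 < det z a a' - det w a a' by lra.
have Et : t * (det z a a' - det w a a') = det z a a' by rewrite /t mulfVK // gt_eqF.
pose c := ((1 - t) * z.1 + t * w.1, (1 - t) * z.2 + t * w.2).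
have cs : segment z w c by apply/segmentP; exists t; split=> //; nra.
have c0 : det c a a' = 0.
  by rewrite (@det_segment0 a a' z w c t) //; nra.
have [|c1 c2] := in_tri c cs; first by rewrite c0.
by exists c; split.
Qed.


(** * Edges as graphs over the abscissa *)

Definition height p f (x : R) : R := p.2 + (f.2 - p.2) / (f.1 - p.1) * (x - p.1).

Lemma det_height p f z : p.1 < f.1 ->
  det p f z = (f.1 - p.1) * (z.2 - height p f z.1).
Proof. by move=> pf; rewrite /det /height; field; lra. Qed.

Lemma height_left p f : height p f p.1 = p.2.
Proof. by rewrite /height subrr mulr0 addr0. Qed.

Lemma height_right p f : p.1 < f.1 -> height p f f.1 = f.2.
Proof. by move=> pf; rewrite /height; field; lra. Qed.

Lemma det_gt0 p f z : p.1 < f.1 -> (0 < det p f z) = (height p f z.1 < z.2).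
Proof. by move=> pf; rewrite det_height // pmulr_rgt0 ?subr_gt0. Qed.

Lemma det_lt0 p f z : p.1 < f.1 -> (det p f z < 0) = (z.2 < height p f z.1).
Proof. by move=> pf; rewrite det_height // pmulr_rlt0 ?subr_gt0 // subr_lt0. Qed.

Lemma segment_height p f x : p.1 <= x -> x <= f.1 -> p.1 < f.1 ->
  segment p f (x, height p f x).
Proof.
move=> px xf pf; apply/segmentP; exists ((x - p.1) / (f.1 - p.1)).
have pf0 : 0 < f.1 - p.1 by lra.
split; [by rewrite divr_ge0 //; lra|by rewrite ler_pdivrMr //; lra| |] => /=.
  by field; lra.
by rewrite /height; field; lra.
Qed.

Lemma segment_heightP p f z : p.1 < f.1 -> segment p f z ->
  [/\ p.1 <= z.1, z.1 <= f.1 & z.2 = height p f z.1].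
Proof.
move=> pf /segmentP[t [t0 t1 z1 z2]]; rewrite z1 z2 /height; split; [nra|nra|].
by field; lra.
Qed.

Lemma height_affine p f x y t :
  height p f ((1 - t) * x + t * y) = (1 - t) * height p f x + t * height p f y.
Proof. by rewrite /height; ring. Qed.

(** An intermediate value argument for the difference of two lines, with an explicit zero. If the
    lines agree at both ends, [A + B] vanishes and [x] itself serves. *)
Lemma heights_cross p f q b x y : p.1 < f.1 -> q.1 < b.1 ->
  p.1 <= x -> q.1 <= x -> x < y -> y <= f.1 -> y <= b.1 ->
  height p f x <= height q b x -> height q b y <= height p f y ->
  exists c, segment p f c /\ segment q b c.
Proof.
move=> pf qb px qx xy yf yb hx hy.
pose A := height q b x - height p f x; pose B := height p f y - height q b y.
have [AB|AB] := eqVneq (A + B) 0.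
  exists (x, height p f x); split; first by apply: segment_height => //; lra.
  have -> : height p f x = height q b x by rewrite /A /B in AB; lra.
  by apply: segment_height => //; lra.
have AB0 : 0 < A + B by rewrite lt_neqAle eq_sym AB /A /B /=; lra.
pose t := A / (A + B); have Et : t * (A + B) = A by rewrite /t mulfVK.
have t0 : 0 <= t by rewrite divr_ge0 ?(ltW AB0) // /A; lra.
have t1 : t <= 1 by rewrite ler_pdivrMr // mul1r /A /B; lra.
pose z := (1 - t) * x + t * y; have xz : x <= z by rewrite /z; nra.
have zy : z <= y by rewrite /z; nra.
exists (z, height p f z); split; first by apply: segment_height => //; lra.
have -> : height p f z = height q b z.
  by rewrite /z !height_affine; move: Et; rewrite /A /B; lra.
by apply: segment_height => //; lra.
Qed.

(** Concavity in three-point form with the denominators cleared. *)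
Definition concave3 (g : R -> R) := forall x y z : R, x < y -> y < z ->
  (z - y) * g x + (y - x) * g z <= (z - x) * g y.

Section ConcaveGraph.
Variable g : R -> R.
Hypothesis g_concave : concave3 g.

Definition under p := p.2 <= g p.1.
Definition high p f := forall x, p.1 <= x -> x <= f.1 -> g x <= height p f x.
Definition low p f := exists x, [/\ p.1 <= x, x < f.1 & height p f x < g x].

Lemma high_or_low p f : p.1 < f.1 -> g f.1 = f.2 -> high p f \/ low p f.
Proof.
move=> pf gf; have [?|nl] := pselect (low p f); [by right|left] => x px.
rewrite le_eqVlt => /orP[/eqP ->|xf]; first by rewrite gf height_right.
by rewrite leNgt; apply/negP => H; apply: nl; exists x.
Qed.

(** Subtracting a line keeps [g] concave, so two values of the gap between graph and edge control
    its sign elsewhere. *)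
Let gap_concave p f (x y z : R) : x < y -> y < z ->
  (z - y) * (g x - height p f x) + (y - x) * (g z - height p f z) <=
  (z - x) * (g y - height p f y).
Proof.
move=> xy yz; have := g_concave xy yz; rewrite /height.
move: ((f.2 - p.2) / (f.1 - p.1)) => m; lra.
Qed.

Lemma gap_gt0l p f (x y z : R) : x < y -> y < z ->
  height p f x <= g x -> height p f z < g z -> height p f y < g y.
Proof. by move=> xy yz hx hz; have := gap_concave p f xy yz; nra. Qed.

Lemma gap_gt0r p f (x y z : R) : x < y -> y < z ->
  height p f x < g x -> height p f z <= g z -> height p f y < g y.
Proof. by move=> xy yz hx hz; have := gap_concave p f xy yz; nra. Qed.

(** The gap is positive somewhere before [f] and zero at [f], so concavity makes it negative
    afterwards. *)
Lemma low_beyond p f x : p.1 < f.1 -> g f.1 = f.2 -> low p f -> f.1 < x ->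
  g x < height p f x.
Proof.
move=> pf gf [y [py yf hy]] fx; rewrite ltNge; apply/negP => H.
by have := gap_gt0r yf fx hy H; rewrite gf height_right // ltxx.
Qed.

Lemma low_under p f x : p.1 < f.1 -> g f.1 = f.2 -> low p f -> under p ->
  p.1 < x -> x < f.1 -> height p f x < g x.
Proof.
move=> pf gf [y [py yf hy]] up px xf.
have hp : height p f p.1 <= g p.1 by rewrite height_left.
case: (ltgtP x y) => [xy|yx|->//]; first exact: gap_gt0l px xy _ _.
by apply: gap_gt0r yx xf _ _ => //; rewrite gf height_right.
Qed.

(** Convexity of the hypograph. Endpoints and vertical segments are treated apart, because
    [concave3] compares three distinct abscissas. *)
Lemma under_segment p q z : under p -> under q -> segment p q z -> under z.
Proof.
wlog pq : p q / p.1 <= q.1.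
  move=> H up uq zs; case: (leP p.1 q.1) => pq; first exact: (H p q).
  by apply: (H q p) => //; [exact: ltW|exact: segment_sym].
rewrite /under => up uq /segmentP[t [t0 t1 z1 z2]].
have [E|tn0] := eqVneq t 0; first by rewrite z1 z2 E subr0 !mul1r !mul0r !addr0.
have [E|tn1] := eqVneq t 1; first by rewrite z1 z2 E subrr !mul1r !mul0r !add0r.
move: pq; rewrite le_eqVlt => /orP[/eqP E|pq].
  have -> : z.1 = q.1 by rewrite z1 E; ring.
  by rewrite E in up; rewrite z2; nra.
have tp : 0 < t by rewrite lt_neqAle eq_sym tn0.
have tp1 : t < 1 by rewrite lt_neqAle tn1.
have pz : p.1 < z.1 by rewrite z1; nra.
have zq : z.1 < q.1 by rewrite z1; nra.
have H := g_concave pz zq; rewrite -(ler_pM2l (x := q.1 - p.1)) ?subr_gt0 //.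
apply: le_trans H.
have -> : q.1 - z.1 = (1 - t) * (q.1 - p.1) by rewrite z1; ring.
have -> : z.1 - p.1 = t * (q.1 - p.1) by rewrite z1; ring.
rewrite z2; have d0 : 0 < q.1 - p.1 by lra.
have -> : (q.1 - p.1) * ((1 - t) * p.2 + t * q.2) =
  (1 - t) * (q.1 - p.1) * p.2 + t * (q.1 - p.1) * q.2 by ring.
by rewrite lerD // ler_wpM2l //; nra.
Qed.

Lemma on_ray_right p a c : p.1 < a.1 -> on_ray p a c ->
  segment p a c \/ (a.1 < c.1 /\ c.2 = height p a c.1).
Proof.
move=> pa [s s0 [c1 c2]]; have [s1|s1] := leP s 1; [left|right].
  by apply/segmentP; exists s; split=> //; rewrite ?c1 ?c2; ring.
by split; [rewrite c1; nra|rewrite c1 c2 /height; field; lra].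
Qed.

Definition disjoint_edges p a q b := forall c, segment p a c -> segment q b c -> False.

(** * Two stars alternating along the chain *)

Section Wedges.
Variables p a a' q b b' : R * R.
Hypotheses (ga : g a.1 = a.2) (ga' : g a'.1 = a'.2) (gb : g b.1 = b.2) (gb' : g b'.1 = b'.2).
Hypotheses (pa : p.1 < a.1) (qb : q.1 < b.1) (qb' : q.1 < b'.1).
Hypotheses (ab : a.1 < b.1) (ba' : b.1 < a'.1).
Hypotheses (dab : disjoint_edges p a q b) (dab' : disjoint_edges p a q b').
Hypotheses (da'b : disjoint_edges p a' q b) (da'b' : disjoint_edges p a' q b').

Let aa' : a.1 < a'.1. Proof. exact: lt_trans ab ba'. Qed.
Let pa' : p.1 < a'.1. Proof. exact: lt_trans pa aa'. Qed.
Let pb : p.1 < b.1. Proof. exact: lt_trans pa ab. Qed.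

(** The path from [b] over [q] to [b'] stays in the cone at [p] spanned by [a'] and [a]: it avoids
    the edges, and their extensions run above the graph while the path stays under it. Between [p]
    and [a] the graph is above the edge [p a], hence outside the cone. *)
Lemma wedge_under : under p -> under q -> low p a -> low p a' -> a.1 < b'.1.
Proof.
move=> up uq la la'.
have D : 0 < det p a' a by rewrite det_gt0 // -ga; exact: low_under.
have z1 : 0 < det p a' b by rewrite det_gt0 // -gb; exact: low_under.
have z2 : 0 < det p b a by rewrite det_swap oppr_gt0 det_lt0 // -gb; exact: low_beyond.
have ub : under b by rewrite /under gb.
have ub' : under b' by rewrite /under gb'.
have ray f y : g f.1 = f.2 -> p.1 < f.1 -> low p f -> g y.1 = y.2 ->
    disjoint_edges p f q y -> forall c, segment q y c -> on_ray p f c -> False.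
  move=> gf pf lf gy dfy c cs /(on_ray_right pf)[cf|[fc hc]]; first exact: (dfy c).
  have uy : under y by rewrite /under gy.
  have := under_segment uq uy cs; rewrite /under hc leNgt.
  by rewrite (low_beyond pf gf lf fc).
have [q1 q2] : 0 < det p a' q /\ 0 < det p q a.
  by apply: (cone_exit D z1 z2) => c /segment_sym; [apply: ray|apply: ray].
have [b1 b2] : 0 < det p a' b' /\ 0 < det p b' a.
  by apply: (cone_exit D q1 q2) => c; [apply: ray|apply: ray].
have pb' : p.1 < b'.1 := cone_right pa' pa D b1 b2.
rewrite ltNge; apply/negP; rewrite le_eqVlt => /orP[/eqP E|b'a].
  by move: b2; rewrite det_swap oppr_gt0 det_lt0 // E height_right // -gb' E ga ltxx.
have := low_under pa ga la up pb' b'a; rewrite gb'.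
by move: b2; rewrite det_swap oppr_gt0 det_lt0 // => /lt_trans /[apply]; rewrite ltxx.
Qed.

Let det_aa' c : (a'.1 - a.1) * det p a c =
  (c.1 - a.1) * det p a a' + (a.1 - p.1) * det a a' c.
Proof. by rewrite /det; ring. Qed.

Let det_cycle c : det c a a' = det a a' c.
Proof. by rewrite /det; ring. Qed.

Let chord x : a.1 <= x -> x <= a'.1 -> 0 <= det (x, g x) a a'.
Proof.
rewrite le_eqVlt => /orP[/eqP <- _|ax]; first by rewrite ga /det /=; nra.
rewrite le_eqVlt => /orP[/eqP ->|xa']; first by rewrite ga' /det /=; nra.
by have := g_concave ax xa'; rewrite ga ga' /det /=; nra.
Qed.

(** From [b], inside the triangle [p a a'], the edge to [q] cannot leave through the chord [a a'],
    since the graph, and with it the high edge, lies above that chord. So [q] is in the triangle.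
    From there the edge to [b'] either leaves through the chord, right of [a], or ends above the
    line [p a], where the graph has no point between [p] and [a]. *)
Lemma wedge_high : ~ segment p a' a -> high p a -> high p a' -> high q b -> a.1 < b'.1.
Proof.
move=> naa' ha ha' hb.
have D : 0 < det p a a'.
  rewrite det_swap oppr_gt0 det_lt0 // lt_neqAle -{2}ga ha' ?ltW // andbT.
  apply/eqP => E; apply: naa'; have := segment_height (ltW pa) (ltW aa') pa'.
  by rewrite -E -surjective_pairing.
have b0 : 0 <= det b a a'.
  by rewrite [b]surjective_pairing -gb; apply: chord; exact: ltW.
have z1 : 0 < det p a b.
  have : 0 < (a'.1 - a.1) * det p a b.
    rewrite det_aa' -det_cycle.
    have : 0 < (b.1 - a.1) * det p a a' by rewrite mulr_gt0 // subr_gt0.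
    have : 0 <= (a.1 - p.1) * det b a a' by rewrite mulr_ge0 // subr_ge0 ltW.
    by lra.
  by rewrite pmulr_rgt0 // subr_gt0.
have z2 : 0 < det p b a'.
  rewrite det_swap oppr_gt0 det_lt0 // lt_neqAle -{2}gb ha' ?ltW // andbT.
  apply/eqP => E; apply: (da'b (segment_height (ltW pb) (ltW ba') pa')).
  by rewrite -E -surjective_pairing; exact: segment_right.
have right_of_a c : 0 < det p a c -> det c a a' = 0 -> a.1 < c.1.
  move=> c1 c0; have := det_aa' c; rewrite -det_cycle c0 mulr0 addr0 => E.
  by rewrite -subr_gt0 -(pmulr_lgt0 _ D) -E mulr_gt0 // subr_gt0.
have [[q1 q2 q0]|[q0 [c [cs c1 c2 c0]]]] :=
    triangle_exit D z1 z2 b0 (fun c cs => @dab c ^~ (segment_sym cs))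
      (fun c cs => @da'b c ^~ (segment_sym cs)).
  have [[b1 b2 _]|[_ [c [cs c1 c2 c0]]]] := triangle_exit D q1 q2 q0 (fun c cs => @dab' c ^~ cs)
      (fun c cs => @da'b' c ^~ cs).
    have pb' := cone_right pa pa' D b1 b2.
    rewrite ltNge; apply/negP => b'a; have := ha _ (ltW pb') b'a.
    by rewrite leNgt gb' -det_gt0 // b1.
  have [_ cb _] := segment_heightP qb' cs.
  exact: lt_le_trans (right_of_a c c1 c0) cb.
exfalso; have ac := right_of_a c c1 c0.
have [qc cb hc] := segment_heightP qb (segment_sym cs).
have {}qc : q.1 < c.1.
  rewrite lt_neqAle qc andbT; apply/eqP => E; move: q0.
  have -> : q = c by apply: injective_projections => //; rewrite hc -E height_left.
  by rewrite c0 ltxx.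
(* At this abscissa the edge is strictly under the chord [a a'] and the chord is under the graph,
   against [hb]. *)
pose x := Num.max q.1 a.1.
have xc : x < c.1 by rewrite gt_max qc ac.
have qx : q.1 <= x by rewrite le_max lexx.
have ax : a.1 <= x by rewrite le_max lexx orbT.
have cq0 : 0 < c.1 - q.1 by rewrite subr_gt0.
have cq : c.1 - q.1 != 0 by rewrite gt_eqF.
pose s := (x - q.1) / (c.1 - q.1).
have Es : s * (c.1 - q.1) = x - q.1 by rewrite /s mulfVK.
have Ex : x = (1 - s) * q.1 + s * c.1 by lra.
have y0 : det (x, height q b x) a a' < 0.
  rewrite (@det_segment0 a a' q c (x, height q b x) s) //=; last first.
    by rewrite {1}Ex height_affine height_left -hc.
  rewrite c0 mulr0 addr0 pmulr_rlt0 // subr_gt0 /s ltr_pdivrMr // mul1r.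
  by rewrite ltrD2r.
have := chord ax (ltW (lt_trans xc (le_lt_trans cb ba'))).
have := hb x qx (ltW (lt_le_trans xc cb)).
move: y0; rewrite /det /=; move: aa' (height q b x) (g x) => h u v.
by nra.
Qed.

End Wedges.

(** * Edges that start above the graph and dive below it *)

Definition is_entry p f e := [/\ p.1 < e, e < f.1, height p f e = g e,
  forall x, e < x -> x < f.1 -> height p f x < g x &
  forall x, p.1 <= x -> x < e -> g x < height p f x].

(** The gap is negative at [p] and positive at some [y]; the intermediate value theorem gives a
    zero, and concavity makes it the only sign change before [f]. *)
Lemma entry_exists p f : continuous g -> p.1 < f.1 -> g f.1 = f.2 -> ~ under p ->
  low p f -> exists e, is_entry p f e.
Proof.
move=> g_cont pf gf /negP; rewrite -ltNge => gp [y [py yf hy]].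
pose phi x := g x - height p f x.
have phi_cont : continuous phi.
  move=> x; apply: cvgB; first exact: g_cont.
  by apply: cvgD; [exact: cvg_cst|apply: cvgMr; apply: cvgB; [exact: cvg_id|exact: cvg_cst]].
have phip : phi p.1 < 0 by rewrite /phi height_left subr_lt0.
have phiy : 0 < phi y by rewrite subr_gt0.
have [||e ey phie] := @IVT R phi p.1 y 0 py.
- exact: continuous_subspaceT.
- by rewrite ge_min le_max (ltW phip) (ltW phiy) orbT.
move: ey; rewrite in_itv /= => /andP[pe ey].
have {}pe : p.1 < e.
  by rewrite lt_neqAle pe andbT; apply/eqP => E; rewrite E phie ltxx in phip.
have {}ey : e < y.
  by rewrite lt_neqAle ey andbT; apply/eqP => E; rewrite -E phie ltxx in phiy.
have he : height p f e = g e by apply/eqP; rewrite eq_sym -subr_eq0; apply/eqP.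
exists e; split=> //; first exact: lt_trans yf.
  move=> x ex xf; case: (ltgtP x y) => [xy|yx|->//].
    by apply: gap_gt0l ex xy _ hy; rewrite he.
  by apply: gap_gt0r yx xf hy _; rewrite gf height_right.
move=> x px xe; rewrite ltNge; apply/negP => H.
by have := gap_gt0l xe ey H hy; rewrite he ltxx.
Qed.

Lemma entry_low p f e : is_entry p f e -> low p f.
Proof.
move=> [pe ef _ H _]; exists ((e + f.1) / 2).
by split; [lra|lra|apply: H; lra].
Qed.

(** At [e'] the edge [p a] is under the graph and [q b] is on it; at [a] the roles are exchanged, so
    the edges would meet. *)
Lemma entry_laminar p a q b e e' : g a.1 = a.2 -> disjoint_edges p a q b ->
  is_entry p a e -> is_entry q b e' -> e < e' -> e' < a.1 -> a.1 < b.1 -> False.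
Proof.
move=> ga dab [pe ea he He _] [qe' e'b he' He' _] ee' e'a ab.
have pa := lt_trans pe ea; have qb := lt_trans qe' e'b.
have [c [ca cb]] : exists c, segment p a c /\ segment q b c.
  apply: (@heights_cross p a q b e' a.1) => //.
  - exact: ltW (lt_trans pe ee').
  - exact: ltW.
  - exact: ltW.
  - by rewrite he' ltW // He.
  - by rewrite (height_right pa) -ga ltW // He'.
exact: (dab c).
Qed.

Lemma entry_inj p a q b e e' : disjoint_edges p a q b ->
  is_entry p a e -> is_entry q b e' -> e != e'.
Proof.
move=> dab [pe ea he _ _] [qe' e'b he' _ _]; apply/eqP => E; rewrite -E in qe' e'b he'.
apply: (dab (e, g e)).
  by rewrite -he; apply: segment_height; [exact: ltW|exact: ltW|exact: lt_trans ea].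
by rewrite -he'; apply: segment_height; [exact: ltW|exact: ltW|exact: lt_trans e'b].
Qed.

(** Beyond [a] the extension of [p a] is above the graph, so the edge to [a'] runs below it and is
    already under the graph at [e]. *)
Lemma entry_nested p a a' e e' : g a.1 = a.2 -> g a'.1 = a'.2 ->
  is_entry p a e -> is_entry p a' e' -> a.1 < a'.1 -> e' < e.
Proof.
move=> ga ga' E E' aa'; have [pe ea he He _] := E; have [pe' e'a' he' _ He'] := E'.
have pa := lt_trans pe ea; have pa' := lt_trans pe' e'a'.
have h := low_beyond pa ga (entry_low E) aa'; rewrite ga' -(height_right pa') in h.
have h' : height p a' e < height p a e.
  move: h; rewrite /height; move: (_ / _) (_ / _) => m m' h.
  by rewrite ltrD2l ltr_pM2r ?subr_gt0 // -(ltr_pM2r (x := a'.1 - p.1)) ?subr_gt0 // -(ltrD2l p.2).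
rewrite ltNge le_eqVlt; apply/negP => /orP[/eqP ee'|ee'].
  by rewrite he ee' he' ltxx in h'.
by rewrite he in h'; have := He' e (ltW pe) ee'; lra.
Qed.

Lemma heights_lt p f q b (x y z : R) : x < y -> y < z ->
  height p f x < height q b x -> height p f z < height q b z ->
  height p f y < height q b y.
Proof.
move=> xy yz; rewrite /height; move: (_ / _) (_ / _) => m m' hx hz; nra.
Qed.

(** The edge [q b] passes under [a] at a point [z] of the triangle [p a' a]. Going left from [z] it
    cannot leave through the chord [a a'], so [q] is in the triangle. The edge to [b'] then leaves
    through the chord, right of [a], or ends below the line [p a], which the graph exceeds between
    [ea] and [a]. *)
Lemma wedge_entry p a a' q b b' ea ea' eb :
  g a.1 = a.2 -> g a'.1 = a'.2 -> g b.1 = b.2 -> g b'.1 = b'.2 ->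
  q.1 < b'.1 -> a.1 < b.1 -> b.1 < a'.1 ->
  disjoint_edges p a q b -> disjoint_edges p a q b' ->
  disjoint_edges p a' q b -> disjoint_edges p a' q b' ->
  is_entry p a ea -> is_entry p a' ea' -> is_entry q b eb -> eb < ea ->
  b'.1 < ea \/ a.1 < b'.1.
Proof.
move=> ga ga' gb gb' qb' ab ba' dab dab' da'b da'b' Ea Ea' Eb eba.
have aa' := lt_trans ab ba'.
have e'a := entry_nested ga ga' Ea Ea' aa'.
have [pea eaa hea Ha Ha0] := Ea; have [pea' eaa' hea' Ha' _] := Ea'.
have [qeb ebb heb Hb _] := Eb.
have pa := lt_trans pea eaa; have pa' := lt_trans pea' eaa'; have qb := lt_trans qeb ebb.
have e'b : ea' < eb.
  case: (ltgtP ea' eb) => // [lt|E].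
    exfalso; apply: (@entry_laminar q b p a' eb ea' gb _ Eb Ea' lt _ ba').
      by move=> c cb ca; apply: (da'b c).
    exact: lt_trans e'a (lt_trans eaa ab).
  by have := entry_inj da'b Ea' Eb; rewrite E eqxx.
have D : 0 < det p a' a by rewrite det_gt0 // -ga; apply: Ha' => //; exact: lt_trans eaa.
have eb_a := lt_trans eba eaa; have qa := lt_trans qeb eb_a.
pose z := (a.1, height q b a.1).
have za : z.2 < a.2 by rewrite -ga; apply: Hb.
have zs : segment q b z by apply: segment_height => //; exact: ltW.
have z1 : 0 < det p a' z.
  rewrite det_gt0 //=; apply: (heights_lt eb_a ab).
    by rewrite heb; apply: Ha' => //; exact: lt_trans ba'.
  by rewrite (height_right qb) -gb; apply: Ha' => //; exact: lt_trans ebb.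
have z2 : 0 < det p z a by rewrite det_swap oppr_gt0 det_lt0 //= height_right.
have z0 : 0 <= det z a' a by rewrite /det /= subrr mulr0 subr0 mulr_ge0 // subr_ge0 ltW.
have right_of_a c : 0 < det p c a -> det c a' a = 0 -> a.1 < c.1.
  move=> c2 c0.
  have E : (a'.1 - a.1) * det p c a = (c.1 - a.1) * det p a' a + (a.1 - p.1) * det c a' a.
    by rewrite /det; ring.
  rewrite c0 mulr0 addr0 in E.
  by rewrite -subr_gt0 -(pmulr_lgt0 _ D) -E mulr_gt0 // subr_gt0.
have zq c : segment z q c -> segment q b c.
  by move=> /segment_sym; exact: segment_trans.
have [[q1 q2 q0]|[q0 [c [cs c1 c2 c0]]]] :=
    triangle_exit D z1 z2 z0 (fun c cs => @da'b c ^~ (zq c cs))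
      (fun c cs => @dab c ^~ (zq c cs)).
  have [[b1 b2 _]|[_ [c [cs c1 c2 c0]]]] := triangle_exit D q1 q2 q0
      (fun c cs => @da'b' c ^~ cs) (fun c cs => @dab' c ^~ cs); last first.
    right; have [_ cb _] := segment_heightP qb' cs.
    exact: lt_le_trans (right_of_a c c2 c0) cb.
  have pb' := cone_right pa' pa D b1 b2.
  have hb' : b'.2 < height p a b'.1 by rewrite -det_lt0 // -oppr_gt0 -det_swap.
  case: (ltgtP b'.1 a.1) => [b'a|b'a|E]; [|by right|]; last first.
    by rewrite E height_right // -gb' E ga ltxx in hb'.
  left; case: (ltgtP b'.1 ea) => // [eb'|E].
    by have := Ha _ eb' b'a; rewrite gb'; move: hb'; lra.
  by rewrite E hea -gb' E ltxx in hb'.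
have := right_of_a c c2 c0; have [_ + _] := @segment_heightP q z c qa (segment_sym cs).
by rewrite /= leNgt => /negbTE ->.
Qed.


End ConcaveGraph.
End PlaneGeometry.

(** * Stars with leaves on a concave chain *)

Section ConcaveInterpolation.
Variable R : realType.

(** The lower envelope of lines given by slope and intercept, built one line at a time; [l0] keeps
    the family nonempty. *)
Lemma min_lines (l0 : R * R) (l : seq (R * R)) : exists g : R -> R,
  [/\ concave3 g, continuous g, forall x, {in l0 :: l, forall m, g x <= m.1 * x + m.2}
    & forall x, exists2 m, m \in l0 :: l & g x = m.1 * x + m.2].
Proof.
have line_cont (m : R * R) : continuous (fun x : R => m.1 * x + m.2).
  by move=> x; apply: cvgD; [apply: cvgMr; exact: cvg_id|exact: cvg_cst].
elim: l => [|l1 l [g [gc gt gle gex]]].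
  exists (fun x => l0.1 * x + l0.2); split=> //.
  - by move=> x y z xy yz; lra.
  - by move=> x m; rewrite inE => /eqP ->.
  - by move=> x; exists l0; rewrite ?inE.
exists (g \min (fun x => l1.1 * x + l1.2)); split.
- move=> x y z xy yz /=.
  have xy0 : 0 <= y - x by lra.
  have yz0 : 0 <= z - y by lra.
  have xz0 : 0 < z - x by lra.
  have [_|_] := leP (g y) (l1.1 * y + l1.2).
    by apply: le_trans (gc x y z xy yz); apply: lerD; apply: ler_wpM2l; rewrite ?ge_min ?lexx.
  apply: (@le_trans _ _ ((z - y) * (l1.1 * x + l1.2) + (y - x) * (l1.1 * z + l1.2))).
    by apply: lerD; apply: ler_wpM2l; rewrite ?ge_min ?lexx ?orbT.
  by lra.
- by move=> x; apply: continuous_min; [exact: gt|exact: line_cont].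
- move=> x m; rewrite !inE => /or3P[ml|/eqP ->|ml]; rewrite /= ge_min ?lexx ?orbT //.
    by rewrite gle // inE ml.
  by rewrite gle // inE ml orbT.
move=> x; rewrite /=; have [_|_] := leP (g x) (l1.1 * x + l1.2); last first.
  by exists l1; rewrite // !inE eqxx orbT.
have [m ml ->] := gex x; exists m => //; move: ml; rewrite !inE => /orP[->//|->].
by rewrite !orbT.
Qed.

Variables (V : finType) (pt : V -> R * R) (S : {set V}).
Hypothesis x_inj : {in S &, injective (fun v => (pt v).1)}.
Hypothesis pt_concave : {in S & &, forall u v w, (pt u).1 < (pt v).1 -> (pt v).1 < (pt w).1 ->
  det (pt u) (pt v) (pt w) <= 0}.

(** Slopes from [v] to points on its right are at most the slopes to points on its left. The largest
    right slope supports; failing that the smallest left slope, and for a single point 0. *)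
Lemma support_slope v : v \in S -> exists s,
  {in S, forall u, (pt u).2 <= (pt v).2 + s * ((pt u).1 - (pt v).1)}.
Proof.
move=> vS; pose sl u := ((pt u).2 - (pt v).2) / ((pt u).1 - (pt v).1).
have slE u : (pt u).1 != (pt v).1 -> sl u * ((pt u).1 - (pt v).1) = (pt u).2 - (pt v).2.
  by move=> uv; rewrite /sl mulfVK // subr_eq0.
have sl_lr u w : u \in S -> w \in S -> (pt u).1 < (pt v).1 -> (pt v).1 < (pt w).1 ->
    sl w <= sl u.
  move=> uS wS uv vw; have := pt_concave uS vS wS uv vw.
  have := slE u; rewrite (lt_eqF uv) => /(_ isT) Eu.
  have := slE w; rewrite (gt_eqF vw) => /(_ isT) Ew.
  have -> : det (pt u) (pt v) (pt w) =
      ((pt v).1 - (pt u).1) * ((pt w).1 - (pt v).1) * (sl w - sl u).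
    have -> : ((pt v).1 - (pt u).1) * ((pt w).1 - (pt v).1) * (sl w - sl u) =
        ((pt v).1 - (pt u).1) * (sl w * ((pt w).1 - (pt v).1)) +
        ((pt w).1 - (pt v).1) * (sl u * ((pt u).1 - (pt v).1)) by ring.
    by rewrite Eu Ew /det; ring.
  by rewrite pmulr_rle0 ?subr_le0 // mulr_gt0 // subr_gt0.
pose Pr u := (u \in S) && ((pt v).1 < (pt u).1).
pose Pl u := (u \in S) && ((pt u).1 < (pt v).1).
suff [s [sr sleft]] : exists s, (forall u, Pr u -> sl u <= s) /\ (forall u, Pl u -> s <= sl u).
  exists s => u uS; case: (ltgtP (pt u).1 (pt v).1) => [uv|vu|/x_inj ->//].
  - have := sleft u; rewrite /Pl uS uv => /(_ isT).
    by have := slE u; rewrite (lt_eqF uv) => /(_ isT); nra.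
  - have := sr u; rewrite /Pr uS vu => /(_ isT).
    by have := slE u; rewrite (gt_eqF vu) => /(_ isT); nra.
  - by rewrite subrr mulr0 addr0.
have [w Pw|nr] := pickP Pr.
  case: (arg_maxP sl Pw) => r /andP[rS vr] rmax; exists (sl r); split=> // u /andP[uS uv].
  exact: sl_lr.
have [w Pw|nl] := pickP Pl.
  case: (arg_minP sl Pw) => r _ rmin; exists (sl r); split=> // u.
  by rewrite nr.
by exists 0; split=> u; rewrite ?nr ?nl.
Qed.

(** The lower envelope of the support lines works: the line at [v] passes through [pt v] and no
    other one passes below it. *)
Lemma concave_interpolation : exists g : R -> R,
  [/\ concave3 g, continuous g & {in S, forall v, g (pt v).1 = (pt v).2}].
Proof.
have [v0 v0S|S0] := pickP (mem S); last first.
  have [g [gc gt _ _]] := min_lines (0, 0) [::].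
  by exists g; split=> // v vS; have := S0 v; rewrite /= vS.
pose s v := xget 0 [set s | {in S, forall u, (pt u).2 <= (pt v).2 + s * ((pt u).1 - (pt v).1)}].
have sP v : v \in S -> {in S, forall u, (pt u).2 <= (pt v).2 + s v * ((pt u).1 - (pt v).1)}.
  by move=> vS; apply: (xgetPex 0 (support_slope vS)).
pose ln v := (s v, (pt v).2 - s v * (pt v).1).
have [g [gc gt gle gex]] := min_lines (ln v0) [seq ln v | v <- enum S].
exists g; split=> // v vS; apply/eqP; rewrite eq_le; apply/andP; split.
  have -> : (pt v).2 = (ln v).1 * (pt v).1 + (ln v).2 by rewrite /ln /=; ring.
  by apply: gle; rewrite inE map_f ?orbT // mem_enum.
have [m ml ->] := gex (pt v).1.
have [u uS ->] : exists2 u, u \in S & m = ln u.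
  move: ml; rewrite inE => /orP[/eqP ->|/mapP[u]]; first by exists v0.
  by rewrite mem_enum => uS ->; exists u.
by apply: le_trans (sP u uS v vS) _; rewrite /ln /= le_eqVlt; apply/orP; left; apply/eqP; ring.
Qed.

End ConcaveInterpolation.

Section StarFamilies.
Variables (R : realType) (V : finType) (k : nat) (col : V -> 'I_k).
Implicit Types (c : 'I_k -> R * R) (pt : V -> R * R) (S : {set V}) (blk : V -> 'I_k).

(** Planarity restricted to the edges that end in [S], in a form that passes to subsets and to
    injective affine images. *)
Definition star_family c pt S :=
  {in S &, forall u v, col u != col v ->
     disjoint_edges (c (col u)) (pt u) (c (col v)) (pt v)} /\
  {in S &, forall u v, col u = col v -> segment (c (col v)) (pt v) (pt u) -> u = v}.

Definition blocked blk (x : V -> R) S :=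
  [/\ {in S &, injective x},
      {in S &, forall u v, col u = col v -> blk u = blk v -> u = v}
    & {in S &, forall u v, x u < x v -> (blk u <= blk v)%N}].

Definition concave_points pt S :=
  {in S & &, forall u v w, (pt u).1 < (pt v).1 -> (pt v).1 < (pt w).1 ->
    det (pt u) (pt v) (pt w) <= 0}.

Lemma star_familyS c pt S S' : S' \subset S -> star_family c pt S -> star_family c pt S'.
Proof.
by move=> /fintype.subsetP sub [h1 h2]; split=> u v /sub uS /sub vS; [exact: h1|exact: h2].
Qed.

Lemma blockedS blk x S S' : S' \subset S -> blocked blk x S -> blocked blk x S'.
Proof.
by move=> /fintype.subsetP sub [h1 h2 h3]; split=> u v /sub uS /sub vS;
  [exact: h1|exact: h2|exact: h3].
Qed.

Lemma concave_pointsS pt S S' : S' \subset S -> concave_points pt S -> concave_points pt S'.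
Proof. by move=> /fintype.subsetP sub h u v w /sub uS /sub vS /sub wS; exact: h. Qed.

Lemma star_family_map c pt S (f : R * R -> R * R) : injective f ->
  (forall t p q, f ((1 - t) *: p + t *: q) = (1 - t) *: f p + t *: f q) ->
  star_family c pt S -> star_family (f \o c) (f \o pt) S.
Proof.
move=> f_inj f_aff [h1 h2]; split=> u v uS vS uv.
  move=> z [t ht <-] [s hs]; rewrite /= -!f_aff => /f_inj E.
  by apply: (h1 u v uS vS uv); [exists t; first exact: ht|exists s].
move=> [t ht]; rewrite /= -f_aff => /f_inj E; apply: (h2 u v uS vS uv).
by exists t.
Qed.

Section Right.
Variables (blk : V -> 'I_k) (c : 'I_k -> R * R) (pt : V -> R * R) (S : {set V}).
Hypothesis stars : star_family c pt S.
Hypothesis blocks : blocked blk (fun v => (pt v).1) S.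
Hypothesis pt_right : {in S, forall v, (c (col v)).1 < (pt v).1}.
Variable g : R -> R.
Hypothesis g_concave : concave3 g.
Hypothesis g_pt : {in S, forall v, g (pt v).1 = (pt v).2}.

Let disjoint_stars u v i j : u \in S -> v \in S -> col u = i -> col v = j -> j != i ->
  disjoint_edges (c i) (pt u) (c j) (pt v).
Proof.
by move=> uS vS <- <- vu; have [s1 _] := stars; apply: s1 => //; rewrite eq_sym.
Qed.

Lemma card_high : {in S, forall v, high g (c (col v)) (pt v)} -> (#|S| <= 3 * k)%N.
Proof.
move=> hi; have [b1 b2 b3] := blocks; have [s1 s2] := stars.
have := card_noncrossing b1 b2 b3; rewrite !mulSn mul0n addn0.
move=> H; apply: leq_trans (H _) _; last first.
  by rewrite addnA !leq_add // card_imset_ord.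
move=> a b aS bS a' b' a'S b'S ca cb cba ab ba'.
have := @wedge_high R g g_concave (c (col a)) (pt a) (pt a') (c (col b)) (pt b) (pt b').
apply; rewrite ?g_pt ?pt_right -?ca -?cb ?pt_right //; rewrite ?ca ?cb.
- exact: disjoint_stars.
- exact: disjoint_stars.
- exact: disjoint_stars.
- exact: disjoint_stars.
- rewrite -ca => H'; have E := s2 a a' aS a'S (esym ca) H'.
  by move: ba'; rewrite -E ltNge (ltW ab).
- exact: hi.
- by rewrite -ca; exact: hi.
- exact: hi.
Qed.

Lemma card_under : {in S, forall v, under g (c (col v)) /\ low g (c (col v)) (pt v)} ->
  (#|S| <= 3 * k)%N.
Proof.
move=> un; have [b1 b2 b3] := blocks; have [s1 s2] := stars.
have := card_noncrossing b1 b2 b3; rewrite !mulSn mul0n addn0.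
move=> H; apply: leq_trans (H _) _; last first.
  by rewrite addnA !leq_add // card_imset_ord.
move=> a b aS bS a' b' a'S b'S ca cb cba ab ba'.
have := @wedge_under R g g_concave (c (col a)) (pt a) (pt a') (c (col b)) (pt b) (pt b').
apply; rewrite ?g_pt ?pt_right -?ca -?cb ?pt_right //; rewrite ?ca ?cb.
- exact: disjoint_stars.
- exact: disjoint_stars.
- exact: disjoint_stars.
- exact: disjoint_stars.
- by have [] := un a aS.
- by have [] := un b bS.
- by have [] := un a aS.
- by rewrite -ca; have [] := un a' a'S.
Qed.

Lemma card_over : continuous g ->
  {in S, forall v, ~ under g (c (col v)) /\ low g (c (col v)) (pt v)} ->
  (#|S| <= 6 * k)%N.
Proof.
move=> g_cont ov; have [b1 b2 b3] := blocks; have [s1 s2] := stars.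
have [v0 v0S|S0] := pickP (mem S); last first.
  by rewrite (_ : S = finset.set0) ?cards0 //; apply/setP => v; rewrite inE; exact: S0.
pose e v : R := xget 0 [set e | is_entry g (c (col v)) (pt v) e].
have eP v : v \in S -> is_entry g (c (col v)) (pt v) (e v).
  move=> vS; have [nu lo] := ov v vS.
  by apply: (xgetPex 0 (entry_exists g_concave g_cont _ _ nu lo)); rewrite ?g_pt ?pt_right.
(* The block of the last leaf at or before [t], and 0 if there is none: monotone in [t], and equal
   to [blk] at the leaves. *)
pose m (t : R) := (\max_(v in S | ((pt v).1 <= t)%R) blk v)%N.
have m_lt t : (m t < k)%N.
  apply: (@leq_ltn_trans k.-1); last by rewrite ltn_predL (leq_ltn_trans _ (ltn_ord (blk v0))).
  apply/bigmax_leqP => v _.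
  by rewrite -ltnS prednK // (leq_ltn_trans _ (ltn_ord (blk v))).
pose B t := Ordinal (m_lt t).
apply: (@card_laminar R V k col blk (fun v => (pt v).1) S b1 b2 b3 e B).
- move=> t u tu /=; apply/bigmax_leqP => v /andP[vS vt].
  by apply: bigop.leq_bigmax_cond; rewrite vS (le_trans vt).
- move=> v vS; apply/val_inj/eqP; rewrite /= eqn_leq; apply/andP; split.
    apply/bigmax_leqP => u /andP[uS]; rewrite le_eqVlt => /orP[/eqP/b1 ->//|].
    exact: b3.
  by apply: bigop.leq_bigmax_cond; rewrite vS lexx.
- by move=> v vS; have [] := eP v vS.
- move=> u v uS vS E; apply/eqP; apply: contraTT isT => uv.
  have [cuv|cuv] := eqVneq (col u) (col v); last first.
    by have := entry_inj (s1 u v uS vS cuv) (eP u uS) (eP v vS); rewrite E eqxx.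
  case: (ltgtP (pt u).1 (pt v).1) => [lt|lt|/b1 E']; last by rewrite E' ?eqxx in uv.
    have Eu := eP u uS; rewrite cuv in Eu.
    by have := entry_nested g_concave (g_pt uS) (g_pt vS) Eu (eP v vS) lt; rewrite E ltxx.
  have Eu := eP u uS; rewrite cuv in Eu.
  by have := entry_nested g_concave (g_pt vS) (g_pt uS) (eP v vS) Eu lt; rewrite E ltxx.
- move=> u v uS vS eu ev uv.
  have [cuv|cuv] := eqVneq (col u) (col v); last first.
    exact: (entry_laminar (g_pt uS) (s1 u v uS vS cuv) (eP u uS) (eP v vS) eu ev uv).
  have Eu := eP u uS; rewrite cuv in Eu.
  have := entry_nested g_concave (g_pt uS) (g_pt vS) Eu (eP v vS) uv.
  by rewrite ltNge (ltW eu).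
- move=> u v uS vS cuv uv; have Eu := eP u uS; rewrite cuv in Eu.
  exact: (entry_nested g_concave (g_pt uS) (g_pt vS) Eu (eP v vS) uv).
move=> a b aS bS a' b' a'S b'S ca cb cba ab ba' eba.
have Ea' := eP a' a'S; rewrite ca in Ea'.
apply: (wedge_entry g_concave (g_pt aS) (g_pt a'S) (g_pt bS) (g_pt b'S) _ ab ba'
  _ _ _ _ (eP a aS) Ea' (eP b bS) eba).
- by rewrite -cb pt_right.
- exact: disjoint_stars.
- exact: disjoint_stars.
- exact: disjoint_stars.
- exact: disjoint_stars.
Qed.

End Right.

(** High edges and low edges with centre under the graph cost [3 * k] each, low edges with centre
    above it [6 * k]. *)
Lemma card_right_chain blk c pt S : star_family c pt S ->
  blocked blk (fun v => (pt v).1) S -> concave_points pt S ->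
  {in S, forall v, (c (col v)).1 < (pt v).1} -> (#|S| <= 12 * k)%N.
Proof.
move=> stars blocks conc right; have [x_inj _ _] := blocks.
have [g [gc gt gp]] := concave_interpolation x_inj conc.
pose H := [set v in S | `[< high g (c (col v)) (pt v) >]]%SET.
pose U := [set v in S :\: H | `[< under g (c (col v)) >]]%SET.
pose O := (S :\: H) :\: U.
have HS : H \subset S by apply/fintype.subsetP => v; rewrite inE => /andP[].
have US : U \subset S by apply/fintype.subsetP => v; rewrite !inE => /andP[/andP[]].
have OS : O \subset S by apply/fintype.subsetP => v; rewrite !finset.in_setD => /andP[_ /andP[]].
have low_nH v : v \in S -> v \notin H -> low g (c (col v)) (pt v).
  move=> vS; rewrite inE vS /= => /asboolPn nh.
  by case: (high_or_low (right v vS) (gp v vS)).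
have cH : (#|H| <= 3 * k)%N.
  apply: (card_high (star_familyS HS stars) (blockedS HS blocks) _ gc) => v.
  - by move=> /(fintype.subsetP HS); exact: right.
  - by move=> /(fintype.subsetP HS); exact: gp.
  - by rewrite inE => /andP[_ /asboolP].
have cU : (#|U| <= 3 * k)%N.
  apply: (card_under (star_familyS US stars) (blockedS US blocks) _ gc) => v.
  - by move=> /(fintype.subsetP US); exact: right.
  - by move=> /(fintype.subsetP US); exact: gp.
  - by rewrite inE finset.in_setD => /andP[/andP[vH vS] /asboolP u]; split=> //; exact: low_nH.
have cO : (#|O| <= 6 * k)%N.
  apply: (card_over (star_familyS OS stars) (blockedS OS blocks) _ gc _ gt) => v.
  - by move=> /(fintype.subsetP OS); exact: right.
  - by move=> /(fintype.subsetP OS); exact: gp.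
  - rewrite finset.in_setD => /andP[+ vSH]; rewrite inE vSH /= => /asboolPn nu; split=> //.
    by move: vSH; rewrite finset.in_setD => /andP[vH vS]; exact: low_nH.
have sub : S \subset H :|: U :|: O.
  apply/fintype.subsetP => v vS; rewrite !finset.in_setU /O !finset.in_setD vS andbT -orbA.
  by case: (v \in H) => //=; case: (v \in U).
apply: leq_trans (subset_leq_card sub) _; apply: leq_trans (leq_card_setU _ _) _.
have -> : (12 * k = 3 * k + 3 * k + 6 * k)%N by rewrite -!mulnDl.
apply: leq_add => //.
by apply: leq_trans (leq_card_setU _ _) _; rewrite leq_add.
Qed.

Lemma card_chain blk c pt S : star_family c pt S ->
  blocked blk (fun v => (pt v).1) S -> concave_points pt S -> (#|S| <= 25 * k)%N.
Proof.
move=> stars blocks conc; have [x_inj cb mono] := blocks.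
pose A := [set v in S | (c (col v)).1 < (pt v).1]%SET.
pose B := [set v in S | (pt v).1 < (c (col v)).1]%SET.
pose C := [set v in S | (pt v).1 == (c (col v)).1]%SET.
have AS : A \subset S by apply/fintype.subsetP => v; rewrite inE => /andP[].
have BS : B \subset S by apply/fintype.subsetP => v; rewrite inE => /andP[].
have CS : C \subset S by apply/fintype.subsetP => v; rewrite inE => /andP[].
have cA : (#|A| <= 12 * k)%N.
  apply: (card_right_chain (star_familyS AS stars) (blockedS AS blocks) (concave_pointsS AS conc)).
  by move=> v; rewrite inE => /andP[].
have cB : (#|B| <= 12 * k)%N.
  (* The reflection reverses the order of the leaves, so the blocks are reversed too; concavity
     survives. *)
  pose f (p : R * R) := (- p.1, p.2).
  apply: (@card_right_chain (fun v => rev_ord (blk v)) (f \o c) (f \o pt)).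
  - apply: star_family_map (star_familyS BS stars).
      by move=> [x1 y1] [x2 y2] [/oppr_inj -> ->].
    by move=> t p q; rewrite /f; apply: injective_projections => //=; rewrite /GRing.scale /=; ring.
  - split=> u v /(fintype.subsetP BS) uS /(fintype.subsetP BS) vS /=.
    + by move=> /oppr_inj; exact: x_inj.
    + by move=> cuv /(congr1 val)/= E; apply: cb => //; apply: rev_ord_inj; exact: val_inj.
    + by rewrite ltrN2 => /(mono _ _ vS uS) H; rewrite leq_sub2l.
  - move=> u v w /(fintype.subsetP BS) uS /(fintype.subsetP BS) vS /(fintype.subsetP BS) wS /=.
    rewrite !ltrN2 => vu wv; have := conc w v u wS vS uS wv vu; rewrite /det /=; lra.
  - by move=> v; rewrite inE /= ltrN2 => /andP[].
(* A leaf straight above or below its centre is the only such leaf of its star, as abscissas are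
   distinct. *)
have cC : (#|C| <= k)%N.
  apply: leq_trans (card_imset_ord col C); rewrite card_in_imset // => u v.
  rewrite !inE => /andP[uS /eqP xu] /andP[vS /eqP xv] cuv; apply: x_inj => //.
  by rewrite xu xv cuv.
have sub : S \subset A :|: B :|: C.
  apply/fintype.subsetP => v vS; rewrite !inE vS /=.
  by case: (ltgtP (c (col v)).1 (pt v).1).
apply: leq_trans (subset_leq_card sub) _; apply: leq_trans (leq_card_setU _ _) _.
have -> : (25 * k = 12 * k + 12 * k + k)%N by rewrite -mulnDl -mulSnr.
apply: leq_add => //.
by apply: leq_trans (leq_card_setU _ _) _; rewrite leq_add.
Qed.

End StarFamilies.

(** * Stars with leaves on a line *)

Section CollinearLeaves.
Variables (R : realType) (V : finType) (k : nat) (col blk : V -> 'I_k).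
Implicit Types (c : 'I_k -> R * R) (pt : V -> R * R) (S : {set V}) (h : R).

(** Beyond the line the extended edges are out of reach of the other star, so the path from [b] over
    its centre to [b'] stays in the cone spanned by [a'] and [a]. *)
Lemma card_below_line c pt S h : star_family col c pt S ->
  blocked col blk (fun v => (pt v).1) S -> {in S, forall v, (pt v).2 = h} ->
  {in S, forall v, (c (col v)).2 < h} -> (#|S| <= #|col @: S| + #|col @: S| + k)%N.
Proof.
move=> [s1 _] [b1 b2 b3] pt_h c_h; apply: card_noncrossing b1 b2 b3 _.
move=> a b aS bS a' b' a'S b'S ca cb cba ab ba'.
have ph := c_h a aS; have qh := c_h b bS.
have ray u v : u \in S -> v \in S -> col u = col a -> col v = col b ->
    forall z, segment (c (col b)) (pt v) z -> on_ray (c (col a)) (pt u) z -> False.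
  move=> uS vS cu cv z zs [s s0 [z1 z2]].
  apply: (s1 u v uS vS _ z); rewrite ?cu ?cv //; first by rewrite eq_sym.
  apply/segmentP; exists s; split=> //; rewrite ?z1 ?z2; try ring.
  case/segmentP: zs => t [t0 t1 _ zt]; move: z2; rewrite zt !pt_h //; nra.
have D : 0 < det (c (col a)) (pt a') (pt a) by rewrite /det !pt_h //; nra.
have z1 : 0 < det (c (col a)) (pt a') (pt b) by rewrite /det !pt_h //; nra.
have z2 : 0 < det (c (col a)) (pt b) (pt a) by rewrite /det !pt_h //; nra.
have [q1 q2] := cone_exit D z1 z2
  (fun z zs => ray a' b a'S bS ca erefl z (segment_sym zs))
  (fun z zs => ray a b aS bS erefl erefl z (segment_sym zs)).
have [_] := cone_exit D q1 q2 (fun z => ray a' b' a'S b'S ca cb z)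
  (fun z => ray a b' aS b'S erefl cb z).
by rewrite /det !pt_h //; nra.
Qed.

Lemma segment_horizontal (p f z : R * R) : p.2 = z.2 -> f.2 = z.2 ->
  (p.1 <= z.1 <= f.1) || (f.1 <= z.1 <= p.1) -> segment p f z.
Proof.
move=> pz fz; have [E|pf] := eqVneq p.1 f.1.
  move=> H; have -> : z = p; last exact: segment_left.
  apply: injective_projections; last exact: esym.
  by case/orP: H => /andP[]; rewrite -E; lra.
have pf0 : f.1 - p.1 != 0 by rewrite subr_eq0 eq_sym.
move=> H; apply/segmentP; exists ((z.1 - p.1) / (f.1 - p.1)); split.
- case/orP: H => /andP[h1 h2]; first by rewrite divr_ge0 //; lra.
  by rewrite -mulrNN -invrN divr_ge0 //; lra.
- case: (ltgtP p.1 f.1) => [lt|lt|E]; last by rewrite E eqxx in pf.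
    by rewrite ler_pdivrMr; case/orP: H => /andP[]; lra.
  by rewrite ler_ndivrMr; case/orP: H => /andP[]; lra.
- by field.
- by rewrite pz fz; field.
Qed.

(** A star has at most one leaf on each side of its centre, since the nearer of two would lie on the
    edge to the farther. *)
Lemma card_on_line c pt S h : star_family col c pt S ->
  {in S, forall v, (pt v).2 = h} -> {in S, forall v, (c (col v)).2 = h} ->
  (#|S| <= #|col @: S| + #|col @: S|)%N.
Proof.
move=> [_ s2] pt_h c_h; pose f v := (col v, (c (col v)).1 <= (pt v).1).
have f_inj : {in S &, injective f}.
  move=> u v uS vS [cuv side].
  wlog uv : u v uS vS cuv side / (pt u).1 <= (pt v).1.
    move=> H; have [?|/ltW vu] := leP (pt u).1 (pt v).1; first exact: H.
    by apply/esym/H.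
  rewrite cuv in side; have [cu|cu] := boolP ((c (col v)).1 <= (pt u).1).
    by apply: s2 => //; apply: segment_horizontal; rewrite ?c_h ?pt_h // cu uv.
  apply/esym; apply: s2 => //; rewrite cuv; apply: segment_horizontal; rewrite ?c_h ?pt_h //.
  by rewrite side -ltNge in cu; rewrite uv (ltW cu) orbT.
rewrite -(card_in_imset f_inj) addnn -muln2 -card_bool -cardsT -cardsX.
apply/subset_leq_card/fintype.subsetP => _ /imsetP[v vS ->].
by rewrite !inE /= imset_f.
Qed.

Lemma card_collinear c pt S h : star_family col c pt S ->
  blocked col blk (fun v => (pt v).1) S -> {in S, forall v, (pt v).2 = h} ->
  (#|S| <= 4 * k)%N.
Proof.
move=> stars blocks pt_h.
pose A := [set v in S | (c (col v)).2 < h]%SET.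
pose B := [set v in S | h < (c (col v)).2]%SET.
pose C := [set v in S | (c (col v)).2 == h]%SET.
have AS : A \subset S by apply/fintype.subsetP => v; rewrite inE => /andP[].
have BS : B \subset S by apply/fintype.subsetP => v; rewrite inE => /andP[].
have CS : C \subset S by apply/fintype.subsetP => v; rewrite inE => /andP[].
have cA : (#|A| <= #|col @: A| + #|col @: A| + k)%N.
  apply: (card_below_line (star_familyS AS stars) (blockedS AS blocks) (h := h)).
    by move=> v /(fintype.subsetP AS); exact: pt_h.
  by move=> v; rewrite inE => /andP[].
have cB : (#|B| <= #|col @: B| + #|col @: B| + k)%N.
  pose f (p : R * R) := (p.1, - p.2).
  apply: (@card_below_line (f \o c) (f \o pt) B (- h)).
  - apply: star_family_map (star_familyS BS stars).
      by move=> [x1 y1] [x2 y2] [-> /oppr_inj ->].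
    by move=> t p q; rewrite /f; apply: injective_projections => //=; rewrite /GRing.scale /=; ring.
  - exact: blockedS BS blocks.
  - by move=> v /(fintype.subsetP BS) vS /=; rewrite pt_h.
  - by move=> v; rewrite inE /= ltrN2 => /andP[].
have cC : (#|C| <= #|col @: C| + #|col @: C|)%N.
  apply: (card_on_line (star_familyS CS stars) (h := h)).
    by move=> v /(fintype.subsetP CS); exact: pt_h.
  by move=> v; rewrite inE => /andP[_ /eqP].
(* The position of the centre puts each star in one class, so the three colour counts add up to at
   most [k]; doubled, and with [k] for each of [A] and [B], they give [4 * k]. *)
have cABC : (#|col @: A| + #|col @: B| + #|col @: C| <= k)%N.
  have := cardsC [set i | (c i).2 < h]%SET; rewrite card_ord => kE.
  rewrite -[X in (_ <= X)%N]kE -addnA; apply: leq_add.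
    by apply/subset_leq_card/fintype.subsetP => _ /imsetP[v + ->]; rewrite !inE => /andP[].
  rewrite -(cardsID [set i | h < (c i).2]%SET (~: _)); apply: leq_add.
    apply/subset_leq_card/fintype.subsetP => _ /imsetP[v + ->]; rewrite !inE => /andP[_ hc].
    by rewrite hc andbT -leNgt ltW.
  apply/subset_leq_card/fintype.subsetP => _ /imsetP[v + ->]; rewrite !inE => /andP[_ /eqP ->].
  by rewrite ltxx.
have sub : S \subset A :|: B :|: C.
  apply/fintype.subsetP => v vS; rewrite !inE vS /=.
  by case: (ltgtP (c (col v)).2 h).
apply: leq_trans (subset_leq_card sub) _; apply: leq_trans (leq_card_setU _ _) _.
apply: leq_trans (leq_add (leq_card_setU _ _) (leqnn _)) _.
apply: leq_trans (leq_add (leq_add cA cB) cC) _.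
move: cABC; move: #|col @: A| #|col @: B| #|col @: C| => x y z xyz.
by lia.
Qed.

End CollinearLeaves.

(** * Drawings of the star forest and the sorted labelling *)

Section StarForestDrawings.
Variables (R : realType) (k : nat) (o : 'I_k).
Hypothesis o0 : val o = 0%N.
Implicit Types (d pi : 'I_k * 'I_k -> R * R) (X : set (R * R)).

Lemma plane_star_family d (S : {set 'I_k * 'I_k}) : plane_drawing (star_forest k) d ->
  {in S, forall v, val v.2 != 0%N} ->
  star_family (fun v => v.1) (fun i => d (i, o)) d S.
Proof.
move=> [d_inj d_vert d_edge] leaf.
have adj v : v \in S -> star_forest k (v.1, o) v.
  by move=> vS; rewrite /star_forest /disjoint_copies /star /= eqxx o0 (negPf (leaf v vS)).
split=> u v uS vS uv.
  move=> z zu zv; have [|w] := d_edge _ _ _ _ (adj u uS) (adj v vS) _ z zu zv.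
    apply/eqP => /setP/(_ u); rewrite !inE eqxx orbT => /esym/orP[/eqP E|/eqP E].
      by have := leaf u uS; rewrite E o0.
    by rewrite E eqxx in uv.
  rewrite !inE => /andP[wu wv] _; case/eqP: uv.
  by have <- : w.1 = u.1; [case/orP: wu => /eqP->|case/orP: wv => /eqP->].
move=> zu; have [E|//] := d_vert _ _ _ (adj v vS) zu.
by have := leaf u uS; rewrite E o0.
Qed.

Lemma card_fixed pi d (B : nat) :
  (#|[set v | (d v == pi v) && (val v.2 != 0%N)]%SET| <= B)%N ->
  (num_fixed pi d <= k + B)%N.
Proof.
move=> HB; pose C := [set v : 'I_k * 'I_k | v.2 == o]%SET.
have cC : (#|C| <= k)%N.
  apply: leq_trans (card_imset_ord (fun v => v.1) C); rewrite card_in_imset // => -[u1 u2] [v1 v2].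
  by rewrite !inE /= => /eqP -> /eqP -> ->.
apply: leq_trans (leq_add cC HB); apply: leq_trans (leq_card_setU _ _).
apply/subset_leq_card/fintype.subsetP => v; rewrite !inE => /= ->.
by rewrite -o0 -val_eqE orbN.
Qed.

Lemma fix_set_le X pi (B : nat) : injective pi -> range pi = X ->
  (forall d, plane_drawing (star_forest k) d -> (num_fixed pi d <= B)%N) ->
  (fix_set (star_forest k) X <= B)%N.
Proof.
move=> pi_inj piX HB.
have [_ H] := @fix_setP R _ (star_forest k) X (ex_intro2 _ _ pi pi_inj piX).
apply: leq_trans (H pi pi_inj piX) _; apply/bigmax_leqP => m /asboolP[d dpl <-].
exact: HB.
Qed.

(* The point of rank [j * k + i] is given to the [i]-th star. *)
Lemma sorted_labelling X (x : R * R -> R) : X #= `I_(k ^ 2) ->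
  {in X &, injective x} -> exists pi, [/\ injective pi, range pi = X &
    forall u v, x (pi u) < x (pi v) -> (u.2 <= v.2)%N].
Proof.
move=> Xk x_inj; have Xfin : finite_set X by exists (k ^ 2)%N.
pose le (p q : R * R) := x p <= x q.
pose s := sort le (finmap.enum_fset (fset_set X)).
have s_size : size s = (k * k)%N by rewrite size_sort (card_fset_set Xk) mulnn.
have s_uniq : uniq s by rewrite sort_uniq finmap.fset_uniq.
have s_mem p : (p \in s) = (p \in X) by rewrite mem_sort -(in_fset_set Xfin).
have s_sorted : sorted le s by apply: sort_sorted => p q; exact: le_total.
pose idx (v : 'I_k * 'I_k) := (v.2 * k + v.1)%N.
have idx_lt v : (idx v < size s)%N.
  rewrite s_size; apply: (@leq_trans (v.2 * k + k)); first by rewrite ltn_add2l.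
  by rewrite -mulSnr leq_mul2r ltn_ord orbT.
have k_gt0 : (0 < k)%N by rewrite (leq_ltn_trans _ (ltn_ord o)).
exists (fun v => nth 0 s (idx v)); split.
- move=> [u1 u2] [v1 v2] /eqP; rewrite nth_uniq // => /eqP E.
  have E1 : u1 = v1.
    by apply: val_inj; have := congr1 (modn ^~ k) E; rewrite /idx /= !modnMDl !modn_small.
  have E2 : u2 = v2.
    apply: val_inj; have := congr1 (divn ^~ k) E.
    by rewrite /idx /= !divnMDl // !divn_small // !addn0.
  by rewrite E1 E2.
- apply/seteqP; split=> [_ [v _ <-]|p pX].
    by apply/set_mem; rewrite -s_mem mem_nth.
  have ps : p \in s by rewrite s_mem; exact: mem_set.
  have i_lt : (index p s < k * k)%N by rewrite -s_size index_mem.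
  have d_lt : (index p s %/ k < k)%N by rewrite ltn_divLR.
  exists (Ordinal (ltn_pmod (index p s) k_gt0), Ordinal d_lt) => //.
  by rewrite /idx /= -divn_eq nth_index.
- move=> u v; apply: contraTT; rewrite -ltnNge -leNgt => vu.
  have uv : (idx v <= idx u)%N.
    rewrite /idx; apply: (@leq_trans (v.2 * k + k)); first by rewrite leq_add2l ltnW.
    by rewrite -mulSnr (leq_trans _ (leq_addr _ _)) // leq_mul2r vu orbT.
  have le_tr : transitive le by move=> p q r; exact: le_trans.
  have le_refl : reflexive le by move=> p; exact: lexx.
  by apply: (sorted_leq_nth le_tr le_refl 0 s_sorted); rewrite ?inE.
Qed.

End StarForestDrawings.

(** * Weakly convex position *)

Section WeaklyConvexPosition.
Variable R : realType.
Implicit Types (p q u v w z : R * R) (K X : set (R * R)).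

(** An injective affine change of coordinates that realises the generic direction as the horizontal
    one. *)
Definition shear (s : R) p : R * R := (p.1 + s * p.2, p.2).

Lemma shear_inj s : injective (shear s).
Proof. by move=> [x1 y1] [x2 y2] [/= + E]; rewrite E => /addIr ->. Qed.

Lemma shear_affine s t p q :
  shear s ((1 - t) *: p + t *: q) = (1 - t) *: shear s p + t *: shear s q.
Proof.
by apply: injective_projections => //=; rewrite /GRing.scale /=; ring.
Qed.

Lemma fresh_real (l : seq R) : exists s, s \notin l.
Proof.
(* If this number were in the list, its absolute value would be one summand of a sum that it
   exceeds. *)
exists (1 + \sum_(r <- l) `|r|); apply/negP => H.
have := ler_norm (1 + \sum_(r <- l) `|r|).
have : 0 <= \sum_(r <- rem (1 + \sum_(r <- l) `|r|) l) `|r| by apply: sumr_ge0.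
have := big_rem (1 + \sum_(r <- l) `|r|) H (F := fun r => `|r|) (P := predT) (op := +%R) (idx := 0).
move=> /= E; move: E; set a := \sum_(r <- l) _; lra.
Qed.

(** A pair with different ordinates rules out a single [s], and a pair with equal ordinates none. *)
Lemma shear_generic X : finite_set X -> exists s, {in X &, injective (fun p => (shear s p).1)}.
Proof.
move=> Xfin; pose l := finmap.enum_fset (fset_set X).
have lX p : p \in X -> p \in l by rewrite -(in_fset_set Xfin).
have [s sl] := fresh_real [seq (p.1 - q.1) / (q.2 - p.2) | p <- l, q <- l].
exists s => p q /lX pl /lX ql /= E.
have [E2|E2] := eqVneq q.2 p.2.
  by apply: injective_projections => //; rewrite E2 in E; apply: addIr E.
case/negP: sl; suff -> : s = (p.1 - q.1) / (q.2 - p.2) by apply: allpairs_f.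
have qp : q.2 - p.2 != 0 by rewrite subr_eq0.
by apply: (mulIf qp); rewrite mulfVK //; lra.
Qed.

Lemma shear_segment s p q z : segment (shear s p) (shear s q) (shear s z) -> segment p q z.
Proof. by move=> [t ht]; rewrite -shear_affine => /shear_inj <-; exists t. Qed.

Lemma convex_segment K p q : convex_set K -> K p -> K q -> segment p q `<=` K.
Proof.
move=> Kc Kp Kq z [t t01 <-]; move: t01; rewrite /= in_itv /= => /andP[t0 t1].
have := Kc q p (Itv01 t0 t1) (mem_set Kq) (mem_set Kp) => /set_mem.
by rewrite addrC.
Qed.

(** Affinity is expressed through three values of [F], so that [ring] can check it for each
    determinant. *)
Lemma open_affine_gt0 (F : R * R -> R) :
  (forall z, F z = (F (1, 0) - F (0, 0)) * z.1 + (F (0, 1) - F (0, 0)) * z.2 + F (0, 0)) ->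
  open [set z | 0 < F z].
Proof.
move=> FE; apply: (@open_comp _ _ F [set x | 0 < x]); last exact: open_gt.
move=> z _; rewrite (_ : F = fun z => (F (1, 0) - F (0, 0)) * z.1 +
  (F (0, 1) - F (0, 0)) * z.2 + F (0, 0)); last exact/funext.
apply: cvgD; last exact: cvg_cst.
by apply: cvgD; (apply: cvgM; first exact: cvg_cst); [exact: cvg_fst|exact: cvg_snd].
Qed.

Lemma segment_vertical p q z : p.1 = z.1 -> q.1 = z.1 -> p.2 < z.2 -> z.2 < q.2 ->
  segment p q z.
Proof.
move=> pz qz pz2 zq2; have pq : 0 < q.2 - p.2 by lra.
apply/segmentP; exists ((z.2 - p.2) / (q.2 - p.2)); split.
- by rewrite divr_ge0 //; lra.
- by rewrite ler_pdivrMr //; lra.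
- by rewrite pz qz; ring.
- by field; lra.
Qed.

(* [v] is interior to the convex hull of [u], [w], [u'] and [w']. *)
Lemma interior_between K s u w u' w' v : convex_set K -> K u -> K w -> K u' -> K w' ->
  (shear s u).1 < (shear s v).1 -> (shear s v).1 < (shear s w).1 ->
  (shear s u').1 < (shear s v).1 -> (shear s v).1 < (shear s w').1 ->
  0 < det (shear s u) (shear s v) (shear s w) ->
  det (shear s u') (shear s v) (shear s w') < 0 -> interior K v.
Proof.
move=> Kc Ku Kw Ku' Kw' uv vw u'v vw' above below.
(* The strict inequalities at [v] define an open set. After the shear, each of its points lies
   vertically between a point of the segment [u' w'] and one of [u w], hence in [K]. *)
pose O := [set z | 0 < (shear s z).1 - (shear s u).1] `&`
  [set z | 0 < (shear s w).1 - (shear s z).1] `&`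
  [set z | 0 < (shear s z).1 - (shear s u').1] `&`
  [set z | 0 < (shear s w').1 - (shear s z).1] `&`
  [set z | 0 < det (shear s u) (shear s z) (shear s w)] `&`
  [set z | 0 < - det (shear s u') (shear s z) (shear s w')].
have O_open : open O.
  by do 5?apply: openI; apply: open_affine_gt0 => z; rewrite /det /shear /=; ring.
have Ov : O v by rewrite /O; repeat split; rewrite //= ?oppr_gt0 // subr_gt0.
suff : O `<=` K by rewrite (open_subsetE _ O_open) => /(_ v Ov).
move=> z [[[[[uz zw] u'z] zw'] ztop] zbot].
have {}uz : (shear s u).1 < (shear s z).1 by rewrite -subr_gt0.
have {}zw : (shear s z).1 < (shear s w).1 by rewrite -subr_gt0.
have {}u'z : (shear s u').1 < (shear s z).1 by rewrite -subr_gt0.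
have {}zw' : (shear s z).1 < (shear s w').1 by rewrite -subr_gt0.
have uw := lt_trans uz zw; have uw' := lt_trans u'z zw'.
have {}ztop : (shear s z).2 < height (shear s u) (shear s w) (shear s z).1.
  by rewrite -det_lt0 // -oppr_gt0 -det_swap.
have {}zbot : height (shear s u') (shear s w') (shear s z).1 < (shear s z).2.
  by rewrite -det_gt0 // det_swap.
pose lift y : R * R := ((shear s z).1 - s * y, y).
have liftE y : shear s (lift y) = ((shear s z).1, y).
  by apply: injective_projections => //=; ring.
have Ktop : K (lift (height (shear s u) (shear s w) (shear s z).1)).
  apply: (convex_segment Kc Ku Kw); apply: (@shear_segment s); rewrite liftE.
  by apply: segment_height => //; exact: ltW.
have Kbot : K (lift (height (shear s u') (shear s w') (shear s z).1)).
  apply: (convex_segment Kc Ku' Kw'); apply: (@shear_segment s); rewrite liftE.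
  by apply: segment_height => //; exact: ltW.
apply: (convex_segment Kc Kbot Ktop); apply: (@shear_segment s); rewrite !liftE.
exact: segment_vertical.
Qed.

(** If both alternatives failed, the two pairs of witnesses would make the boundary point [v]
    interior to [K]. *)
Lemma weakly_convex_dichotomy X s v : weakly_convex_position X -> X v ->
  {in X &, forall u w, (shear s u).1 < (shear s v).1 -> (shear s v).1 < (shear s w).1 ->
    det (shear s u) (shear s v) (shear s w) <= 0} \/
  {in X &, forall u w, (shear s u).1 < (shear s v).1 -> (shear s v).1 < (shear s w).1 ->
    0 <= det (shear s u) (shear s v) (shear s w)}.
Proof.
move=> [K [Kcomp Kconv _] XK] Xv.
have Kcl : closure K = K.
  by apply/esym/closure_id; apply: compact_closed => //; exact: norm_hausdorff.
have inK p : p \in X -> K p by move=> /set_mem/XK[]; rewrite Kcl.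
have [?|/existsNP[u /existsNP[w H]]] := pselect (forall u w, u \in X -> w \in X ->
    (shear s u).1 < (shear s v).1 -> (shear s v).1 < (shear s w).1 ->
    det (shear s u) (shear s v) (shear s w) <= 0); first by left.
right=> u' w' u'X w'X u'v vw'; rewrite leNgt; apply/negP => below.
apply: H => uX wX uv vw; rewrite leNgt; apply/negP => above.
have [_] := XK v Xv; apply.
exact: (interior_between Kconv (inK u uX) (inK w wX) (inK u' u'X) (inK w' w'X) uv vw u'v vw').
Qed.

End WeaklyConvexPosition.

(** * The bounds *)

Section FixSetBounds.
Variables (R : realType) (k : nat).
Hypothesis k_gt0 : (0 < k)%N.
Implicit Types (d pi : 'I_k * 'I_k -> R * R) (X : set (R * R)).

Let o : 'I_k := Ordinal k_gt0.

(** The block of a vertex is its number within the star, so star and block determine it. *)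
Lemma blocked_fixed X pi d (x : R * R -> R) (S : {set 'I_k * 'I_k}) :
  injective pi -> range pi = X -> {in X &, injective x} ->
  (forall u v, x (pi u) < x (pi v) -> (u.2 <= v.2)%N) -> {in S, d =1 pi} ->
  blocked (fun v => v.1) (fun v => v.2) (x \o d) S.
Proof.
move=> pi_inj piX x_inj mono dpi.
have pX v : pi v \in X by apply/mem_set; rewrite -piX; exists v.
split=> [u v uS vS|[u1 u2] [v1 v2] _ _ /= -> -> //|u v uS vS] /=; rewrite !dpi //.
  by move=> /x_inj H; apply/pi_inj/H.
exact: mono.
Qed.

Lemma fix_set_collinear X : X #= `I_(k ^ 2) -> collinear X ->
  (fix_set (star_forest k) X <= 5 * k)%N.
Proof.
move=> Xk [a [b [c [ab0 Xline]]]].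
have ab : 0 < a ^+ 2 + b ^+ 2.
  rewrite lt_neqAle addr_ge0 ?sqr_ge0 // andbT eq_sym.
  apply: contraNneq ab0 => /eqP; rewrite paddr_eq0 ?sqr_ge0 // !sqrf_eq0.
  by move=> /andP[/eqP -> /eqP ->].
(* A similarity that takes the given line to the horizontal line at height [c]. *)
pose f (p : R * R) := (b * p.1 - a * p.2, a * p.1 + b * p.2).
have f_inj : injective f.
  move=> p q [E1 E2]; apply: injective_projections; apply: (mulfI (lt0r_neq0 ab)).
    have -> : (a ^+ 2 + b ^+ 2) * p.1 = b * (b * p.1 - a * p.2) + a * (a * p.1 + b * p.2) by ring.
    by rewrite E1 E2; ring.
  have -> : (a ^+ 2 + b ^+ 2) * p.2 = b * (a * p.1 + b * p.2) - a * (b * p.1 - a * p.2) by ring.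
  by rewrite E1 E2; ring.
have f2 p : p \in X -> (f p).2 = c by move=> /set_mem/Xline.
have x_inj : {in X &, injective (fun p => (f p).1)}.
  by move=> p q pX qX E; apply/f_inj/injective_projections => //; rewrite !f2.
have [pi [pi_inj piX mono]] := sorted_labelling o Xk x_inj.
(* The bound splits into [k] for the centres and [4 * k] for the leaves. *)
apply: (fix_set_le pi_inj piX) => d dpl; rewrite mulSn.
apply: (@card_fixed R k o erefl); set S := [set v | _]%SET.
have dpi : {in S, d =1 pi} by move=> v; rewrite inE => /andP[/eqP].
apply: (@card_collinear R _ k (fun v => v.1) (fun v => v.2) (f \o (fun i => d (i, o))) (f \o d) S c).
- apply: star_family_map => //; first last.
    by apply: plane_star_family => // v; rewrite inE => /andP[].
  by move=> t p q; apply: injective_projections; rewrite /f /= /GRing.scale /=; ring.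
- exact: (blocked_fixed pi_inj piX x_inj mono dpi).
- by move=> v vS /=; rewrite -(f2 (d v)) // dpi //; apply/mem_set; rewrite -piX; exists v.
Qed.

Lemma fix_set_weakly_convex X : X #= `I_(k ^ 2) -> weakly_convex_position X ->
  (fix_set (star_forest k) X <= 51 * k)%N.
Proof.
move=> Xk Xconv; have Xfin : finite_set X by exists (k ^ 2)%N.
have [s x_inj] := shear_generic Xfin.
have [pi [pi_inj piX mono]] := sorted_labelling o Xk x_inj.
apply: (fix_set_le pi_inj piX) => d dpl; rewrite mulSn.
apply: (@card_fixed R k o erefl); set S := [set v | _]%SET.
have dpi : {in S, d =1 pi} by move=> v; rewrite inE => /andP[/eqP].
have dX v : v \in S -> d v \in X.
  by move=> vS; rewrite dpi //; apply/mem_set; rewrite -piX; exists v.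
have stars : star_family (fun v => v.1) (fun i => d (i, o)) d S.
  by apply: plane_star_family => // v; rewrite inE => /andP[].
have blocks := blocked_fixed pi_inj piX x_inj mono dpi.
pose upper p := `[< {in X &, forall u w, (shear s u).1 < (shear s p).1 ->
  (shear s p).1 < (shear s w).1 -> det (shear s u) (shear s p) (shear s w) <= 0} >].
pose U := [set v in S | upper (d v)]%SET.
have US : U \subset S by apply/fintype.subsetP => v; rewrite inE => /andP[].
have cU : (#|U| <= 25 * k)%N.
  apply: (@card_chain R _ k (fun v => v.1) (fun v => v.2)
    (shear s \o (fun i => d (i, o))) (shear s \o d)).
  - apply: star_family_map (star_familyS US stars); first exact: shear_inj.
    exact: shear_affine.
  - exact: blockedS US blocks.
  - move=> u v w /(fintype.subsetP US) uS + /(fintype.subsetP US) wS.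
    by rewrite inE => /andP[_ /asboolP H]; apply: H; exact: dX.
(* Leaves outside [U] form a convex chain by the dichotomy, which this reflection turns into a
   concave one. *)
pose f p := let q := shear s p in (q.1, - q.2).
have LS : S :\: U \subset S by exact: subsetDl.
have cL : (#|S :\: U| <= 25 * k)%N.
  apply: (@card_chain R _ k (fun v => v.1) (fun v => v.2)
    (f \o (fun i => d (i, o))) (f \o d)).
  - apply: star_family_map (star_familyS LS stars).
      move=> p q [E1 /oppr_inj E2]; apply: (@shear_inj _ s).
      exact: injective_projections.
    move=> t p q; rewrite /f; apply: injective_projections => /=;
      by rewrite /shear /GRing.scale /=; ring.
  - exact: blockedS LS blocks.
  - move=> u v w /(fintype.subsetP LS) uS + /(fintype.subsetP LS) wS.
    rewrite finset.in_setD inE => /andP[+ vS]; rewrite vS /= => /asboolPn nup uv vw.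
    have [//|low] := weakly_convex_dichotomy s Xconv (set_mem (dX v vS)).
    by have := low _ _ (dX u uS) (dX w wS) uv vw; rewrite /det /=; lra.
rewrite -(cardsID U) (_ : 50 * k = 25 * k + 25 * k)%N; last by rewrite -mulnDl.
by apply: leq_add => //; apply: leq_trans cU; exact/subset_leq_card/subsetIr.
Qed.

End FixSetBounds.

Theorem theorem5p4 (R : realType) :
  (forall k n : nat, (2 <= k)%N -> n = (k ^ 2)%N ->
     forall X : set (R * R), X #= `I_n -> collinear X ->
       (fix_set (star_forest k) X)%:R < 7 * Num.sqrt (n%:R : R)) /\
  (exists c0 : R, forall k n : nat, (2 <= k)%N -> n = (k ^ 2)%N ->
     forall X : set (R * R), X #= `I_n -> weakly_convex_position X ->
       (fix_set (star_forest k) X)%:R <=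
         c0 * Num.sqrt (n%:R : R) *
           2 ^+ inverse_ackermann (Num.sqrt (n%:R : R))).
Proof.
have sqrt_sq k : Num.sqrt ((k ^ 2)%:R : R) = k%:R.
  by rewrite natrX sqrtr_sqr ger0_norm.
split=> [k n k2 -> X Xk Xcol|].
  rewrite sqrt_sq; have k_gt0 := ltnW k2.
  apply: (@le_lt_trans _ _ (5 * k)%:R).
    by rewrite ler_nat; exact: fix_set_collinear.
  by rewrite natrM ltr_pM2r ?ltr_nat ?ltr0n.
(* One [k] for the centres and [25 * k] for each chain; the power of 2 is at least 1, so the linear
   bound suffices. *)
exists 51 => k n k2 -> X Xk Xconv; rewrite sqrt_sq.
apply: (@le_trans _ _ (51 * k)%:R).
  by rewrite ler_nat; apply: fix_set_weakly_convex => //; exact: ltnW.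
by rewrite natrM ler_peMr ?mulr_ge0 // exprn_ege1 // ler1n.
Qed.
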